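(* Let $c_0>0$, $\alpha_0>0$, and let $\gamma>0$ be a real number that is not an odd integer. Let $\tilde\alpha_0=\alpha_0/\cos(\frac{\pi}{2}\gamma)$ and $\alpha^*_{pl}(\omega)=\tilde\alpha_0(-i\omega)^\gamma$ for $\omega\in\mathbb{R}$. Then the function $K(\vec x,t)=\frac{1}{\sqrt{2\pi}}\mathcal{F}^{-1}\{e^{-\alpha^*_{pl}(\cdot)|\vec x|}\}(t)$ is causal (i.e. $t\mapsto K(\vec x,t)$ vanishes for $t<0$ for every $\vec x\in\mathbb{R}^3$) if and only if $\gamma\in(0,1)$.
   Context: Fourier convention: $\mathcal{F}^{-1}\{\hat f\}(t)=\frac{1}{\sqrt{2\pi}}\int_{\mathbb{R}}e^{-i\omega t}\hat f(\omega)\,d\omega$ (tempered distributions). Complex powers are principal: for $w=re^{i\phi}$, $\phi\in(-\pi,\pi)$, $w^\gamma=e^{\gamma(\log r+i\phi)}$; thus $\alpha^*_{pl}(\omega)=\tilde\alpha_0|\omega|^\gamma(\cos(\frac{\pi}{2}\gamma)-i\,\mathrm{sgn}(\omega)\sin(\frac{\pi}{2}\gamma))$. *)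

(* Defs.v *)
From Stdlib Require Import Reals.
From Coquelicot Require Import Coquelicot.
Open Scope R_scope.

Definition cexp (z : C) : C :=
  (exp (fst z) * cos (snd z), exp (fst z) * sin (snd z)).

(* principal argument in (-pi, pi] (the value at 0 is irrelevant) *)
Definition carg (z : C) : R :=
  let a := fst z in let b := snd z in
  if Rlt_dec 0 a then atan (b / a)
  else if Rlt_dec a 0 then
    (if Rle_dec 0 b then atan (b / a) + PI else atan (b / a) - PI)
  else (if Rlt_dec 0 b then PI / 2 else - (PI / 2)).

Definition cpow (w : C) (g : R) : C :=
  if Req_EM_T (Cmod w) 0 then RtoC 0
  else cexp (g * ln (Cmod w), g * carg w).

Definition alpha_tilde (alpha0 gamma : R) : R := alpha0 / cos (PI / 2 * gamma).

Definition alpha_pl (alpha0 gamma omega : R) : C :=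
  Cmult (RtoC (alpha_tilde alpha0 gamma)) (cpow (0, - omega) gamma).

Definition norm3 (x : R * R * R) : R :=
  let '(x1, x2, x3) := x in sqrt (x1 ^ 2 + x2 ^ 2 + x3 ^ 2).

Definition symbol (alpha0 gamma : R) (x : R * R * R) (omega : R) : C :=
  cexp (Copp (Cmult (alpha_pl alpha0 gamma omega) (RtoC (norm3 x)))).

Definition smooth (phi : R -> R) : Prop := forall n t, ex_derive_n phi n t.

(* inverse Fourier transform of a test function supported in [a,b]:
   (1/sqrt(2 pi)) int_a^b e^{-i omega t} phi(t) dt *)
Definition inv_ft_test (phi : R -> R) (a b omega : R) : C :=
  @scal R_AbsRing C_R_NormedModule (/ sqrt (2 * PI))
    (@RInt C_R_CompleteNormedModule (fun t => Cmult (cexp (0, - (omega * t))) (RtoC (phi t))) a b).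

(* K(x,.) = (1/sqrt(2pi)) F^{-1}{symbol} as a tempered distribution;
   causality: K(x,.) vanishes (as a distribution) on the open set t < 0, i.e.
   <K(x,.), phi> = (1/sqrt(2pi)) int_R symbol(omega) (F^{-1}phi)(omega) d omega = 0
   for every smooth phi with compact support in (-oo, 0). *)
Definition K_causal (alpha0 gamma : R) (x : R * R * R) : Prop :=
  forall (phi : R -> R) (a b : R),
    smooth phi -> b < 0 -> (forall t, (t < a \/ b < t) -> phi t = 0) ->
    @is_RInt_gen C_R_NormedModule
      (fun omega => @scal R_AbsRing C_R_NormedModule (/ sqrt (2 * PI))
                      (Cmult (symbol alpha0 gamma x omega) (inv_ft_test phi a b omega)))
      (Rbar_locally m_infty) (Rbar_locally p_infty) (RtoC 0).

Definition odd_integer (g : R) : Prop := exists k : Z, g = IZR (2 * k + 1).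

(* Main.v *)
(** For [0 < gamma < 1] and a test function phi supported in [[a, b]] with [b < 0], the function
    [m(w) Phi(w)], with [m(w) = exp (- k (-i w)^gamma)] and [Phi(w)] the integral of
    [e^{-i w t} phi(t)], is holomorphic in the upper half-plane, where [|m| <= 1] because
    [gamma < 1] keeps [(-i w)^gamma] in the right half-plane, and where [Phi] is bounded and
    [O(|w|^-2)].  Under [w = i e^zeta] the half-plane becomes the strip
    [|Im zeta| <= pi/2], on which the integrand is entire; Cauchy's theorem on the rectangle
    [|Re zeta| <= ln B] bounds the integral of [m Phi] over [1/B <= |w| <= B] by [O(1/B)].

    For [gamma > 1], take [|x| = 1].  On the real line [|m(w)| = exp (- alpha0 |w|^gamma)] decays
    faster than every exponential.  Testing causality against the even derivatives of one bump function phi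
    shows that all even moments of [mu = Re (m Phi)] vanish.  The Fejer kernel
    [(1 - cos (N w)) / w^2] is a power series in [w^2] of exponential type [N], so [mu] integrates to [0] against
    it as well; since that kernel concentrates at [0] as [N] grows, [mu 0 <= 0], whereas
    [mu 0] is the integral of phi, which is positive. *)
Require Import Defs.
From Stdlib Require Import Reals Lra Lia Factorial.
From Coquelicot Require Import Coquelicot.
Open Scope R_scope.

(** * Complex differentiation and the complex exponential *)

(** The substitution [e^z = -i w] turns [(-i w)^gamma] into [e^(gamma z)], which removes the branch
    point at 0, and it turns half-annuli into rectangles. On a rectangle Cauchy's theorem is only
    differentiation under the integral sign in [Im z] combined with the Cauchy-Riemann equations, so
    no contour theory is involved. Since [-i w = e^z] is also the Laplace variable, the negative
    support of phi enters only through [|e^(t e^z)| <= 1]. For gamma > 1 the normalisation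
    [alpha_tilde * cos (pi gamma / 2) = alpha0] makes [|m|] decay whatever the sign of
    [alpha_tilde], so a single argument serves all the intervals between odd integers. Even
    derivatives are used because each pair of derivatives multiplies the spectrum by the real number
    [-w^2], which commutes with taking real parts. The Fejer kernel suits the contradiction because
    it is nonnegative, has mass of order N near 0, and away from 0 has a bound free of N. Its Taylor
    error is beaten by the superexponential decay of mu, so only finitely many moments are used at a
    time. *)

Notation is_Cderive := (@is_derive C_AbsRing (AbsRing_NormedModule C_AbsRing)).

(** Unfolds the filter-based little-o over [C_AbsRing] into a statement about [Cmod], the form in
    which the exponential and the Laplace integral are differentiated. *)
Lemma is_Cderive_eps (f : C -> C) (z l : C) :
  is_Cderive f z l <->
  forall eps, 0 < eps -> exists delta, 0 < delta /\
    forall w, Cmod (w - z) < delta ->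
      Cmod (f w - f z - (w - z) * l) <= eps * Cmod (w - z).
Proof.
  split.
  - intros [_ H] eps Heps.
    destruct (H z (fun P HP => HP) (mkposreal eps Heps)) as [d Hd].
    exists d; split; [apply cond_pos|]. intros w Hw. exact (Hd w Hw).
  - intros H. split; [apply (@is_linear_scal_l C_AbsRing (AbsRing_NormedModule C_AbsRing))|].
    intros x Hx.
    assert (E : z = x) by exact (@is_filter_lim_locally_unique C_AbsRing (AbsRing_NormedModule C_AbsRing) z x Hx).
    subst x. intros eps. destruct (H eps (cond_pos eps)) as [d [Hd Hw]].
    exists (mkposreal d Hd). intros w Hb. exact (Hw w Hb).
Qed.

Lemma cexp_plus (z w : C) : cexp (z + w) = (cexp z * cexp w)%C.
Proof.
  unfold cexp, Cmult, Cplus; simpl. rewrite exp_plus, cos_plus, sin_plus.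
  apply f_equal2; ring.
Qed.

Lemma cexp_0 : cexp 0 = RtoC 1.
Proof. unfold cexp; simpl. rewrite exp_0, cos_0, sin_0. apply f_equal2; ring. Qed.

Lemma Cmod_cexp (z : C) : Cmod (cexp z) = exp (fst z).
Proof.
  unfold Cmod, cexp; simpl fst; simpl snd.
  replace (_ + _) with (Rsqr (exp (fst z)) * (Rsqr (sin (snd z)) + Rsqr (cos (snd z))))
    by (unfold Rsqr; ring).
  rewrite sin2_cos2, Rmult_1_r. apply sqrt_Rsqr. left; apply exp_pos.
Qed.

Lemma Rderive_eps (f : R -> R) (x l : R) :
  is_derive f x l ->
  forall eps, 0 < eps -> exists delta, 0 < delta /\
    forall h, Rabs h < delta -> Rabs (f (x + h) - f x - l * h) <= eps * Rabs h.
Proof.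
  intros H eps Heps. apply is_derive_Reals in H.
  destruct (H eps Heps) as [d Hd]. exists d; split; [apply cond_pos|].
  intros h Hh. destruct (Req_dec h 0) as [->|Hn].
  - rewrite Rplus_0_r, Rabs_R0. replace (_ - _ - _) with 0 by ring. rewrite Rabs_R0; lra.
  - specialize (Hd h Hn Hh).
    replace (f (x + h) - f x - l * h) with (((f (x + h) - f x) / h - l) * h) by (field; assumption).
    rewrite Rabs_mult. apply Rmult_le_compat_r; [apply Rabs_pos|lra].
Qed.

Lemma Cmod_le_abs (z : C) : Cmod z <= Rabs (fst z) + Rabs (snd z).
Proof.
  unfold Cmod. apply Rsqr_incr_0_var.
  - rewrite Rsqr_sqrt by nra.
    assert (H1 := Rsqr_abs (fst z)). assert (H2 := Rsqr_abs (snd z)).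
    assert (0 <= Rabs (fst z) * Rabs (snd z)) by (apply Rmult_le_pos; apply Rabs_pos).
    unfold Rsqr in *. simpl. nra.
  - assert (A := Rabs_pos (fst z)); assert (B := Rabs_pos (snd z)); lra.
Qed.

Lemma fst_le_Cmod (z : C) : Rabs (fst z) <= Cmod z.
Proof. eapply Rle_trans; [apply Rmax_l|apply Rmax_Cmod]. Qed.

Lemma snd_le_Cmod (z : C) : Rabs (snd z) <= Cmod z.
Proof. eapply Rle_trans; [apply Rmax_r|apply Rmax_Cmod]. Qed.

(** The derivative of [cexp] at 0, assembled from the real derivatives of [exp], [cos] and [sin] at
    0. Every other complex derivative of an exponential is reduced to it. *)
Lemma cexp_sub_1 (eps : R) (Heps : 0 < eps) :
  exists delta, 0 < delta /\ forall h, Cmod h < delta ->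
    Cmod (cexp h - 1 - h) <= eps * Cmod h.
Proof.
  assert (He : is_derive exp 0 1) by (rewrite <- exp_0; apply is_derive_exp).
  assert (Hc : is_derive cos 0 0)
    by (apply is_derive_Reals; replace 0 with (- sin 0) at 2 by (rewrite sin_0; ring);
        apply derivable_pt_lim_cos).
  assert (Hs : is_derive sin 0 1)
    by (apply is_derive_Reals; rewrite <- cos_0; apply derivable_pt_lim_sin).
  (* The four error terms below sum to at most [8 * (e * r)], so a tenth of [eps] leaves room;
     [e <= 1] gives [|1 + x| <= 2] and [|sin y| <= 2 * r]. *)
  set (e := Rmin (eps / 10) 1).
  assert (e0 : 0 < e) by (apply Rmin_pos; lra).
  assert (e1 : e <= 1) by apply Rmin_r.
  assert (e2 : e <= eps / 10) by apply Rmin_l.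
  destruct (Rderive_eps _ _ _ He e e0) as [d1 [p1 H1]].
  destruct (Rderive_eps _ _ _ Hc e e0) as [d2 [p2 H2]].
  destruct (Rderive_eps _ _ _ Hs e e0) as [d3 [p3 H3]].
  exists (Rmin (Rmin d1 d2) (Rmin d3 e)). split.
  { repeat apply Rmin_pos; lra. }
  intros [x y] Hh.
  assert (Hx := fst_le_Cmod (x, y)). assert (Hy := snd_le_Cmod (x, y)). simpl in Hx, Hy.
  set (r := Cmod (x, y)) in *.
  assert (r < d1 /\ r < d2 /\ r < d3 /\ r < e) as (L1 & L2 & L3 & L4).
  { repeat split; eapply Rlt_le_trans; try apply Hh.
    - eapply Rle_trans; apply Rmin_l.
    - eapply Rle_trans; [apply Rmin_l|apply Rmin_r].
    - eapply Rle_trans; [apply Rmin_r|apply Rmin_l].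
    - eapply Rle_trans; apply Rmin_r. }
  specialize (H1 x ltac:(lra)). specialize (H2 y ltac:(lra)). specialize (H3 y ltac:(lra)).
  rewrite Rplus_0_l in H1, H2, H3. rewrite exp_0 in H1. rewrite cos_0 in H2. rewrite sin_0 in H3.
  assert (Hr : 0 <= r) by apply Cmod_ge_0.
  assert (Q : forall u, Rabs u <= r -> e * Rabs u <= e * r)
    by (intros; apply Rmult_le_compat_l; lra).
  assert (Q1 := Q _ Hx). assert (Q2 := Q _ Hy).
  eapply Rle_trans; [apply Cmod_le_abs|].
  unfold cexp, Cminus, Cplus, Copp, RtoC; simpl fst; simpl snd.
  replace (exp x * cos y + - (1) + - x) with
    ((exp x - 1 - 1 * x) * cos y + (1 + x) * (cos y - 1 - 0 * y)) by ring.
  replace (exp x * sin y + - 0 + - y) with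
    ((exp x - 1 - 1 * x + x) * sin y + (sin y - 0 - 1 * y)) by ring.
  assert (Cy : Rabs (cos y) <= 1) by (apply Rabs_le; apply COS_bound).
  assert (Sy : Rabs (sin y) <= 2 * r).
  { replace (sin y) with ((sin y - 0 - 1 * y) + y) by ring.
    eapply Rle_trans; [apply Rabs_triang|]. nra. }
  assert (A1 : Rabs ((exp x - 1 - 1 * x) * cos y) <= e * r).
  { rewrite Rabs_mult. assert (0 <= Rabs (exp x - 1 - 1 * x)) by apply Rabs_pos.
    assert (0 <= Rabs (cos y)) by apply Rabs_pos. nra. }
  assert (A2 : Rabs ((1 + x) * (cos y - 1 - 0 * y)) <= 2 * (e * r)).
  { rewrite Rabs_mult. apply Rmult_le_compat; try apply Rabs_pos; try lra.
    eapply Rle_trans; [apply Rabs_triang|]. rewrite Rabs_R1. lra. }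
  assert (A3 : Rabs ((exp x - 1 - 1 * x + x) * sin y) <= 4 * (e * r)).
  { rewrite Rabs_mult. replace (4 * (e * r)) with ((2 * e) * (2 * r)) by ring.
    apply Rmult_le_compat; try apply Rabs_pos; try lra.
    eapply Rle_trans; [apply Rabs_triang|]. nra. }
  assert (T1 := Rabs_triang ((exp x - 1 - 1 * x) * cos y) ((1 + x) * (cos y - 1 - 0 * y))).
  assert (T2 := Rabs_triang ((exp x - 1 - 1 * x + x) * sin y) (sin y - 0 - 1 * y)).
  assert (e * r <= eps / 10 * r) by (apply Rmult_le_compat_r; lra).
  assert (0 <= eps * r) by (apply Rmult_le_pos; lra).
  lra.
Qed.

(** The addition formula carries the estimate at 0 to [z], at the price of the factor
    [Cmod (cexp z)], by which [eps] is divided beforehand. *)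
Lemma is_Cderive_cexp (z : C) : is_Cderive cexp z (cexp z).
Proof.
  apply is_Cderive_eps. intros eps Heps.
  assert (Hp : 0 < eps / Cmod (cexp z))
    by (rewrite Cmod_cexp; apply Rdiv_lt_0_compat; [lra|apply exp_pos]).
  destruct (cexp_sub_1 _ Hp) as [d [Hd H]]. exists d; split; [exact Hd|].
  intros w Hw. specialize (H _ Hw).
  assert (E : w = (z + (w - z))%C) by ring. rewrite E at 1. rewrite cexp_plus.
  replace (_ - _ - _)%C with (cexp z * (cexp (w - z) - 1 - (w - z)))%C by ring.
  rewrite Cmod_mult.
  assert (0 < Cmod (cexp z)) by (rewrite Cmod_cexp; apply exp_pos).
  replace (eps * Cmod (w - z)) with (Cmod (cexp z) * (eps / Cmod (cexp z) * Cmod (w - z)))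
    by (field; lra).
  apply Rmult_le_compat_l; lra.
Qed.

Lemma is_Cderive_mult (f g : C -> C) (z df dg : C) :
  is_Cderive f z df -> is_Cderive g z dg ->
  is_Cderive (fun w => (f w * g w)%C) z (df * g z + f z * dg)%C.
Proof. intros Hf Hg. exact (@is_derive_mult C_AbsRing f g z df dg Hf Hg Cmult_comm). Qed.

Lemma is_Cderive_comp (f g : C -> C) (z df dg : C) :
  is_Cderive f (g z) df -> is_Cderive g z dg ->
  is_Cderive (fun w => f (g w)) z (dg * df)%C.
Proof. intros Hf Hg. exact (@is_derive_comp C_AbsRing (AbsRing_NormedModule C_AbsRing) f g z df dg Hf Hg). Qed.

Lemma is_Cderive_scale (c z : C) : is_Cderive (fun w => (c * w)%C) z c.
Proof.
  apply is_Cderive_eps. intros eps Heps. exists 1; split; [lra|]. intros w _.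
  replace (_ - _ - _)%C with (RtoC 0) by ring. rewrite Cmod_0.
  apply Rmult_le_pos; [lra|apply Cmod_ge_0].
Qed.

Lemma is_Cderive_plus (f g : C -> C) (z df dg : C) :
  is_Cderive f z df -> is_Cderive g z dg ->
  is_Cderive (fun w => (f w + g w)%C) z (df + dg)%C.
Proof. intros Hf Hg. exact (@is_derive_plus C_AbsRing (AbsRing_NormedModule C_AbsRing) f g z df dg Hf Hg). Qed.

(** [C_AbsRing] has the balls of [Cmod] and [C_UniformSpace] the product balls; [locally_C]
    identifies their neighbourhoods, so that complex derivatives yield the continuity that real
    integration expects. *)
Lemma Cderive_continuous (f : C -> C) (z l : C) :
  is_Cderive f z l ->
  @continuous C_UniformSpace C_UniformSpace f z.
Proof.
  intros H.
  assert (K := @ex_derive_continuous C_AbsRing (AbsRing_NormedModule C_AbsRing) f z (ex_intro _ l H)).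
  intros P HP. apply locally_C. apply (K P). apply locally_C. exact HP.
Qed.

Lemma is_derive_eps_R (g : R -> R) (x l : R) :
  (forall eps, 0 < eps -> exists delta, 0 < delta /\
    forall h, Rabs h < delta -> Rabs (g (x + h) - g x - l * h) <= eps * Rabs h) ->
  is_derive g x l.
Proof.
  intros H. apply is_derive_Reals. intros eps Heps.
  destruct (H (eps / 2)) as [d [Hd K]]; [lra|].
  exists (mkposreal d Hd). intros h Hn Hh. specialize (K h Hh).
  assert (0 < Rabs h) by (apply Rabs_pos_lt; exact Hn).
  replace ((g (x + h) - g x) / h - l) with ((g (x + h) - g x - l * h) / h) by (field; exact Hn).
  rewrite Rabs_div by exact Hn. apply Rmult_lt_reg_r with (Rabs h); [lra|].
  unfold Rdiv. rewrite Rmult_assoc, Rinv_l by lra. nra.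
Qed.

(** Chain rule along an affine path with velocity [v]. The velocities [1] and [Ci] together give the
    Cauchy-Riemann equations; with [f := cexp] and velocity [w] it differentiates [e^(t w)] in
    [t]. *)
Lemma Cderive_path (f : C -> C) (p : R -> C) (x : R) (v l : C) :
  (forall h : R, p (x + h)%R = (p x + RtoC h * v)%C) ->
  is_Cderive f (p x) l ->
  is_derive (fun t => fst (f (p t))) x (fst (v * l)%C) /\
  is_derive (fun t => snd (f (p t))) x (snd (v * l)%C).
Proof.
  intros Hp Hf. rewrite is_Cderive_eps in Hf.
  assert (H : forall eps, 0 < eps -> exists delta, 0 < delta /\ forall h, Rabs h < delta ->
     Cmod (f (p (x + h)%R) - f (p x) - RtoC h * (v * l)) <= eps * Rabs h).
  { intros eps Heps. assert (V := Cmod_ge_0 v).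
    destruct (Hf (eps / (Cmod v + 1))) as [d [Hd K]]; [apply Rdiv_lt_0_compat; lra|].
    exists (d / (Cmod v + 1)). split; [apply Rdiv_lt_0_compat; lra|].
    intros h Hh.
    assert (E : (p (x + h)%R - p x = RtoC h * v)%C) by (rewrite Hp; ring).
    specialize (K (p (x + h))). rewrite E, Cmod_mult, Cmod_R in K.
    replace (RtoC h * (v * l))%C with (RtoC h * v * l)%C by ring.
    assert (A := Rabs_pos h).
    assert (B : Rabs h * (Cmod v + 1) < d).
    { apply Rmult_lt_compat_r with (r := Cmod v + 1) in Hh; [|lra].
      unfold Rdiv in Hh. rewrite Rmult_assoc, Rinv_l in Hh; lra. }
    eapply Rle_trans; [apply K; nra|].
    assert (0 <= eps / (Cmod v + 1)) by (apply Rlt_le, Rdiv_lt_0_compat; lra).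
    replace (eps * Rabs h) with (eps / (Cmod v + 1) * (Rabs h * (Cmod v + 1))) by (field; lra).
    apply Rmult_le_compat_l; nra. }
  split; apply is_derive_eps_R; intros eps Heps; destruct (H eps Heps) as [d [Hd K]];
    exists d; (split; [exact Hd|]); intros h Hh; eapply Rle_trans; try apply (K h Hh);
    [ eapply Rle_trans; [|apply fst_le_Cmod] | eapply Rle_trans; [|apply snd_le_Cmod] ];
    right; f_equal; destruct v, l, (f (p (x + h))), (f (p x)); simpl; ring.
Qed.

(** * Cauchy's theorem on rectangles *)

Lemma continuous_pair_2d (f : C -> R) (x y : R) :
  @continuous C_UniformSpace R_UniformSpace f (x, y) -> continuity_2d_pt (fun u v => f (u, v)) x y.
Proof.
  intros H. apply continuity_2d_pt_filterlim. simpl.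
  apply filterlim_ext with (2 := H). intros [u v]; reflexivity.
Qed.

Lemma continuous_fst_C (f : C -> C) z :
  @continuous C_UniformSpace C_UniformSpace f z ->
  @continuous C_UniformSpace R_UniformSpace (fun w => fst (f w)) z.
Proof.
  intros H. apply (continuous_comp f fst); [exact H|]. apply continuous_fst.
Qed.

Lemma continuous_snd_C (f : C -> C) z :
  @continuous C_UniformSpace C_UniformSpace f z ->
  @continuous C_UniformSpace R_UniformSpace (fun w => snd (f w)) z.
Proof.
  intros H. apply (continuous_comp f snd); [exact H|]. apply continuous_snd.
Qed.

Lemma continuity_2d_pt_swap (f : R -> R -> R) x y :
  continuity_2d_pt f x y -> continuity_2d_pt (fun u v => f v u) y x.
Proof.
  intros H eps. destruct (H eps) as [d Hd]. exists d. intros u v Hu Hv. apply Hd; assumption.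
Qed.

Lemma continuity_2d_pt_1d_2 (f : R -> R -> R) x y :
  continuity_2d_pt f x y -> continuous (fun v => f x v) y.
Proof.
  intros H P [e He]. destruct (H e) as [d Hd]. exists d. intros v Hv. apply He.
  apply Hd; [rewrite Rminus_eq_0, Rabs_R0; apply cond_pos|exact Hv].
Qed.

(** The horizontal integral of [u] has derivative in [t] equal to the integral of [p]. As [p] is
    also the [s]-derivative of [q], this is [q s1 t - q s0 t], which only sees the vertical sides;
    the mean value theorem concludes. *)
Lemma cauchy_strip_component (u p q : R -> R -> R) (s0 s1 : R) (D psi0 psi1 : R) :
  (forall s t, is_derive (fun t => u s t) t (p s t)) ->
  (forall s t, is_derive (fun s => q s t) s (p s t)) ->
  (forall s t, continuity_2d_pt p s t) ->
  (forall s t, continuous (fun s => u s t) s) ->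
  psi0 <= psi1 ->
  (forall t, psi0 <= t <= psi1 -> Rabs (q s1 t - q s0 t) <= D) ->
  Rabs (RInt (fun s => u s psi1) s0 s1 - RInt (fun s => u s psi0) s0 s1) <= D * (psi1 - psi0).
Proof.
  intros Hu Hq Hp Hc Hle HD.
  assert (E : forall s t, Derive (fun t => u s t) t = p s t)
    by (intros; apply is_derive_unique, Hu).
  assert (HJ : forall t, is_derive (fun t => RInt (fun s => u s t) s0 s1) t (q s1 t - q s0 t)).
  { intros t.
    replace (q s1 t - q s0 t) with (RInt (fun s => Derive (fun t => u s t) t) s0 s1).
    - apply (is_derive_RInt_param (fun t s => u s t)).
      + apply filter_forall. intros x s _. eexists; apply Hu.
      + intros s _. apply continuity_2d_pt_ext with (fun u v => p v u).
        * intros x y; symmetry; apply E.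
        * apply continuity_2d_pt_swap, Hp.
      + apply filter_forall. intros y. apply (@ex_RInt_continuous R_CompleteNormedModule).
        intros z _. apply Hc.
    - apply is_RInt_unique. apply is_RInt_ext with (fun s => p s t).
      + intros; symmetry; apply E.
      + apply (@is_RInt_derive R_CompleteNormedModule (fun s => q s t)).
        * intros; apply Hq.
        * intros s _. apply (continuity_2d_pt_1d_2 (fun t s => p s t)).
          apply continuity_2d_pt_swap, Hp. }
  destruct (MVT_gen (fun t => RInt (fun s => u s t) s0 s1) psi0 psi1 (fun t => q s1 t - q s0 t))
    as [c [Hc1 Hc2]].
  - intros x _. exact (HJ x).
  - intros x _. apply continuity_pt_filterlim.
    apply (@ex_derive_continuous R_AbsRing R_NormedModule (fun t => RInt (fun s => u s t) s0 s1) x).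
    exists (q s1 x - q s0 x). exact (HJ x).
  - rewrite Hc2, Rabs_mult, (Rabs_pos_eq (psi1 - psi0)) by lra.
    apply Rmult_le_compat_r; [lra|]. apply HD.
    rewrite Rmin_left, Rmax_right in Hc1; lra.
Qed.

(** By Cauchy-Riemann the previous lemma applies with [u = Re F], [q = - Im F], and again with
    [u = Im F], [q = Re F]. The factor 2 comes from bounding [Cmod] by the sum of the two
    components. *)
Lemma cauchy_rectangle (F F' : C -> C) (s0 s1 D psi0 psi1 : R) :
  (forall z, is_Cderive F z (F' z)) ->
  (forall z, @continuous C_UniformSpace C_UniformSpace F' z) ->
  psi0 <= psi1 ->
  (forall t, psi0 <= t <= psi1 -> Cmod (F (s1, t)) + Cmod (F (s0, t)) <= D) ->
  Cmod (@RInt C_R_CompleteNormedModule (fun s => F (s, psi1)) s0 s1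
        - @RInt C_R_CompleteNormedModule (fun s => F (s, psi0)) s0 s1) <= 2 * (D * (psi1 - psi0)).
Proof.
  intros HF HF' Hle HD.
  assert (Hv : forall s t, is_derive (fun t => fst (F (s, t))) t (- snd (F' (s, t))) /\
                           is_derive (fun t => snd (F (s, t))) t (fst (F' (s, t)))).
  { intros s t. destruct (Cderive_path F (fun t => (s, t)) t Ci (F' (s, t))) as [A B].
    - intros h. unfold Cplus, Cmult, Ci; simpl. apply f_equal2; ring.
    - apply HF.
    - split; [eapply is_derive_ext_loc; [|eapply eq_rect; [exact A|]]|
              eapply is_derive_ext_loc; [|eapply eq_rect; [exact B|]]];
      try (apply filter_forall; reflexivity); unfold Cmult, Ci; simpl; ring. }
  assert (Hh : forall s t, is_derive (fun s => fst (F (s, t))) s (fst (F' (s, t))) /\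
                           is_derive (fun s => snd (F (s, t))) s (snd (F' (s, t)))).
  { intros s t. destruct (Cderive_path F (fun s => (s, t)) s 1 (F' (s, t))) as [A B].
    - intros h. unfold Cplus, Cmult, RtoC; simpl. apply f_equal2; ring.
    - apply HF.
    - rewrite Cmult_1_l in A, B. split; assumption. }
  assert (C1 : forall s t, continuity_2d_pt (fun u v => fst (F' (u, v))) s t)
    by (intros; apply (continuous_pair_2d (fun z => fst (F' z))), continuous_fst_C, HF').
  assert (C2 : forall s t, continuity_2d_pt (fun u v => snd (F' (u, v))) s t)
    by (intros; apply (continuous_pair_2d (fun z => snd (F' z))), continuous_snd_C, HF').
  assert (K1 : forall s t, continuous (fun s => fst (F (s, t))) s)
    by (intros s t; apply (@ex_derive_continuous R_AbsRing R_NormedModule (fun s => fst (F (s, t))) s);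
        exists (fst (F' (s, t))); exact (proj1 (Hh s t))).
  assert (K2 : forall s t, continuous (fun s => snd (F (s, t))) s)
    by (intros s t; apply (@ex_derive_continuous R_AbsRing R_NormedModule (fun s => snd (F (s, t))) s);
        exists (snd (F' (s, t))); exact (proj2 (Hh s t))).
  assert (D1 : forall t, psi0 <= t <= psi1 -> Rabs (fst (F (s1, t)) - fst (F (s0, t))) <= D).
  { intros t Ht. specialize (HD t Ht). assert (A := fst_le_Cmod (F (s1, t))).
    assert (B := fst_le_Cmod (F (s0, t))).
    assert (T := Rabs_triang (fst (F (s1, t))) (- fst (F (s0, t)))). rewrite Rabs_Ropp in T.
    unfold Rminus; lra. }
  assert (D2 : forall t, psi0 <= t <= psi1 ->
     Rabs (- snd (F (s1, t)) - - snd (F (s0, t))) <= D).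
  { intros t Ht. specialize (HD t Ht). assert (A := snd_le_Cmod (F (s1, t))).
    assert (B := snd_le_Cmod (F (s0, t))).
    replace (- snd (F (s1, t)) - - snd (F (s0, t))) with (snd (F (s0, t)) + - snd (F (s1, t))) by ring.
    assert (T := Rabs_triang (snd (F (s0, t))) (- snd (F (s1, t)))). rewrite Rabs_Ropp in T. lra. }
  assert (E1 := cauchy_strip_component (fun s t => fst (F (s, t))) (fun s t => - snd (F' (s, t)))
    (fun s t => - snd (F (s, t))) s0 s1 D psi0 psi1 (fun s t => proj1 (Hv s t))
    (fun s t => is_derive_opp _ _ _ (proj2 (Hh s t)))
    (fun s t => continuity_2d_pt_opp _ _ _ (C2 s t)) K1 Hle D2).
  assert (E2 := cauchy_strip_component (fun s t => snd (F (s, t))) (fun s t => fst (F' (s, t)))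
    (fun s t => fst (F (s, t))) s0 s1 D psi0 psi1 (fun s t => proj2 (Hv s t))
    (fun s t => (proj1 (Hh s t))) C1 K2 Hle D1).
  assert (Hpair : forall t, @RInt C_R_CompleteNormedModule (fun s => F (s, t)) s0 s1 =
     (RInt (fun s => fst (F (s, t))) s0 s1, RInt (fun s => snd (F (s, t))) s0 s1)).
  { intros t. apply is_RInt_unique.
    apply (@is_RInt_fct_extend_pair R_NormedModule R_NormedModule);
      apply (@RInt_correct R_CompleteNormedModule), (@ex_RInt_continuous R_CompleteNormedModule);
      intros z _; [apply K1|apply K2]. }
  rewrite !Hpair. eapply Rle_trans; [apply Cmod_le_abs|].
  simpl in *. unfold Rminus in E1, E2. lra.
Qed.

(** * Laplace transforms of functions on a segment *)

Notation RIntC := (@RInt C_R_CompleteNormedModule).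
Notation is_RIntC := (@is_RInt C_R_NormedModule).

Lemma norm_R_Cmod (z : C) : @norm R_AbsRing C_R_NormedModule z = Cmod z.
Proof. symmetry; apply Cmod_norm. Qed.

(** Integration here is over [C] as a real normed module, whose [scal] takes real factors only; a
    complex constant has to be moved out componentwise. *)
Lemma is_RIntC_mult (c : C) (f : R -> C) (a b : R) (l : C) :
  is_RIntC f a b l -> is_RIntC (fun t => (c * f t)%C) a b (c * l)%C.
Proof.
  intros H.
  assert (H1 := is_RInt_fct_extend_fst f a b l H : is_RInt _ _ _ _).
  assert (H2 := is_RInt_fct_extend_snd f a b l H : is_RInt _ _ _ _).
  apply (@is_RInt_fct_extend_pair R_NormedModule R_NormedModule).
  - exact (is_RInt_minus _ _ _ _ _ _ (is_RInt_scal _ _ _ (fst c) _ H1) (is_RInt_scal _ _ _ (snd c) _ H2)).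
  - apply (is_RInt_ext (fun t => plus (scal (fst c) (snd (f t))) (scal (snd c) (fst (f t))))).
    + intros; simpl. unfold plus, scal, mult; simpl. unfold mult; simpl. ring.
    + replace (fst c * snd l + snd c * fst l) with
        (plus (scal (fst c) (snd l)) (scal (snd c) (fst l))) by (unfold plus, scal, mult; simpl; unfold mult; simpl; ring).
      exact (is_RInt_plus _ _ _ _ _ _ (is_RInt_scal _ _ _ (fst c) _ H2) (is_RInt_scal _ _ _ (snd c) _ H1)).
Qed.

Lemma continuous_C_pair (f : R -> C) (t : R) :
  continuous (fun s => fst (f s)) t -> continuous (fun s => snd (f s)) t ->
  @continuous R_UniformSpace C_UniformSpace f t.
Proof.
  intros H1 H2.
  apply (continuous_ext (fun s => (fst (f s), snd (f s)))); [intros; symmetry; apply surjective_pairing|].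
  apply (continuous_comp_2 (fun s => fst (f s)) (fun s => snd (f s)) (fun x y => (x, y))); try assumption.
  apply continuous_ext with (fun z => z); [intros [? ?]; reflexivity|apply continuous_id].
Qed.

Lemma is_RIntC_continuous (f : R -> C) (a b : R) :
  (forall t, @continuous R_UniformSpace C_UniformSpace f t) ->
  is_RIntC f a b (RIntC f a b).
Proof.
  intros H. apply (@RInt_correct C_R_CompleteNormedModule).
  apply (@ex_RInt_continuous C_R_CompleteNormedModule). intros z _. apply H.
Qed.

Lemma exp_le (x y : R) : x <= y -> exp x <= exp y.
Proof. intros [H| ->]; [left; apply exp_increasing, H|lra]. Qed.

(** The kernel is [e^(t w)] without a minus sign, so the right half-plane goes with functions
    supported in [t <= 0]; at [(0, - omega)] it is the Fourier integral of the test function,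
    without its constant. *)
Definition laplace (phi : R -> R) (a b : R) (w : C) : C :=
  RIntC (fun t => (cexp (RtoC t * w) * RtoC (phi t))%C) a b.

Section Laplace.
Variables (phi : R -> R) (a b : R).
Hypothesis Hphi : forall t, continuous phi t.

Lemma continuous_laplace_integrand (w : C) (t : R) :
  @continuous R_UniformSpace C_UniformSpace (fun t => (cexp (RtoC t * w) * RtoC (phi t))%C) t.
Proof.
  destruct w as [u v]. unfold cexp; simpl.
  assert (E : forall c d, continuous (fun s => s * c - 0 * d) t)
    by (intros; apply (@ex_derive_continuous R_AbsRing R_NormedModule); auto_derive; exact I).
  assert (E' : forall c d, continuous (fun s => s * c + 0 * d) t)
    by (intros; apply (@ex_derive_continuous R_AbsRing R_NormedModule); auto_derive; exact I).
  assert (X : continuous (fun s => exp (s * u - 0 * v)) t)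
    by (apply (continuous_comp _ exp); [apply E|apply continuous_exp]).
  assert (Y : continuous (fun s => cos (s * v + 0 * u)) t)
    by (apply (continuous_comp _ cos); [apply E'|apply continuous_cos]).
  assert (Z : continuous (fun s => sin (s * v + 0 * u)) t)
    by (apply (continuous_comp _ sin); [apply E'|apply continuous_sin]).
  assert (M : forall f g : R -> R, continuous f t -> continuous g t -> continuous (fun s => f s * g s) t)
    by (intros f g; apply (@continuous_mult R_UniformSpace R_AbsRing)).
  assert (Ze : continuous (fun _ : R => 0) t) by apply continuous_const.
  apply continuous_C_pair; simpl.
  - apply (@continuous_minus R_UniformSpace R_AbsRing R_NormedModule
      (fun s => exp (s * u - 0 * v) * cos (s * v + 0 * u) * phi s)
      (fun s => exp (s * u - 0 * v) * sin (s * v + 0 * u) * 0)).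
    + apply M; [apply M|]; auto.
    + apply M; [apply M|]; auto.
  - apply (@continuous_plus R_UniformSpace R_AbsRing R_NormedModule
      (fun s => exp (s * u - 0 * v) * cos (s * v + 0 * u) * 0)
      (fun s => exp (s * u - 0 * v) * sin (s * v + 0 * u) * phi s)).
    + apply M; [apply M|]; auto.
    + apply M; [apply M|]; auto.
Qed.

Lemma is_RInt_laplace (w : C) :
  is_RIntC (fun t => (cexp (RtoC t * w) * RtoC (phi t))%C) a b (laplace phi a b w).
Proof. apply is_RIntC_continuous, continuous_laplace_integrand. Qed.

Lemma Cmod_RIntC_le (f : R -> C) (l : C) (M : R) :
  a <= b -> is_RIntC f a b l -> (forall t, a <= t <= b -> Cmod (f t) <= M) ->
  Cmod l <= (b - a) * M.
Proof.
  intros Hab H HM. rewrite <- norm_R_Cmod.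
  apply (norm_RInt_le_const f a b l M Hab); [|exact H].
  intros x Hx. rewrite norm_R_Cmod. apply HM, Hx.
Qed.

(** Here the negative support acts: [t <= 0] and [0 <= Re w] give [|e^(t w)| <= 1]. *)
Lemma Cmod_laplace_le (w : C) (M : R) :
  a <= b -> b <= 0 -> 0 <= fst w -> (forall t, a <= t <= b -> Rabs (phi t) <= M) ->
  Cmod (laplace phi a b w) <= (b - a) * M.
Proof.
  intros Hab Hb Hw HM. apply (Cmod_RIntC_le _ _ _ Hab (is_RInt_laplace w)).
  intros t Ht. rewrite Cmod_mult, Cmod_cexp, Cmod_R. simpl.
  rewrite <- (Rmult_1_l M). apply Rmult_le_compat.
  - left; apply exp_pos.
  - apply Rabs_pos.
  - rewrite <- exp_0. destruct (Rle_lt_or_eq_dec (t * fst w - 0 * snd w) 0) as [H| ->]; [nra| |lra].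
    left; apply exp_increasing, H.
  - apply HM, Ht.
Qed.

Lemma bounded_on_segment : a <= b -> exists M, 0 <= M /\ forall t, a <= t <= b -> Rabs (phi t) <= M.
Proof.
  intros Hab. destruct (continuity_ab_maj (fun t => Rabs (phi t)) a b Hab) as [m [Hm _]].
  - intros c _. apply continuity_pt_filterlim.
    apply (continuous_comp phi Rabs); [apply Hphi|apply continuous_Rabs].
  - exists (Rabs (phi m)). split; [apply Rabs_pos|exact Hm].
Qed.

End Laplace.

(** The remainder is the integral of [e^(t w) (e^(t h) - 1 - t h) phi(t)]. On the segment, [T]
    bounds [|t|] and [B] bounds [|e^(t w)|], so [cexp_sub_1] applies uniformly in [t]; [S] collects
    these constants. *)
Lemma is_Cderive_laplace (phi : R -> R) (a b : R) (w : C) :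
  (forall t, continuous phi t) -> a <= b ->
  is_Cderive (laplace phi a b) w (laplace (fun t => t * phi t) a b w).
Proof.
  intros Hphi Hab.
  assert (Hphi1 : forall t, continuous (fun t => t * phi t) t).
  { intros t. apply (@continuous_mult R_UniformSpace R_AbsRing); [apply continuous_id|apply Hphi]. }
  destruct (bounded_on_segment phi a b Hphi Hab) as [M [M0 HM]].
  set (T := Rabs a + Rabs b + 1).
  assert (T0 : 0 < T) by (assert (A := Rabs_pos a); assert (B := Rabs_pos b); unfold T; lra).
  assert (HT : forall t, a <= t <= b -> Rabs t <= T).
  { intros t Ht. unfold T. assert (A := Rabs_pos a); assert (B := Rabs_pos b).
    unfold Rabs in *; repeat destruct Rcase_abs in |- *; repeat destruct Rcase_abs in *; lra. }
  set (B := exp (T * Rabs (fst w))).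
  assert (B0 : 0 < B) by apply exp_pos.
  set (S := (b - a) * (B * T * M)).
  assert (S0 : 0 <= S).
  { unfold S. apply Rmult_le_pos; [lra|]. apply Rmult_le_pos; [apply Rmult_le_pos; lra|lra]. }
  apply is_Cderive_eps. intros eps Heps.
  assert (e0 : 0 < eps / (S + 1)) by (apply Rdiv_lt_0_compat; lra).
  destruct (cexp_sub_1 _ e0) as [d [Hd K]].
  exists (d / T). split; [apply Rdiv_lt_0_compat; lra|].
  intros w' Hw'. set (h := (w' - w)%C) in *.
  assert (HI := is_RInt_minus _ _ _ _ _ _
    (is_RInt_minus _ _ _ _ _ _ (is_RInt_laplace phi a b Hphi w') (is_RInt_laplace phi a b Hphi w))
    (is_RIntC_mult h _ _ _ _ (is_RInt_laplace _ a b Hphi1 w))).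
  assert (Hm := Cmod_ge_0 h).
  assert (Fin : Cmod (laplace phi a b w' - laplace phi a b w - h * laplace (fun t => t * phi t) a b w)
    <= (b - a) * (B * T * M * (eps / (S + 1) * Cmod h))).
  { apply (Cmod_RIntC_le a b _ _ _ Hab HI).
    intros t Ht.
    assert (E : w' = (w + h)%C) by (unfold h; ring).
    replace (minus _ _) with
      (cexp (RtoC t * w) * (cexp (RtoC t * h) - 1 - RtoC t * h) * RtoC (phi t))%C.
    2:{ rewrite E, Cmult_plus_distr_l, cexp_plus, RtoC_mult.
        match goal with |- _ = minus (minus ?A ?B) ?D =>
          change (minus (minus A B) D) with (A - B - D)%C end. ring. }
    rewrite !Cmod_mult, Cmod_cexp, Cmod_R.
    assert (Ct : Cmod (RtoC t * h) <= T * Cmod h).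
    { rewrite Cmod_mult, Cmod_R. apply Rmult_le_compat_r; [lra|apply HT, Ht]. }
    assert (Cd : T * Cmod h < d).
    { apply Rmult_lt_compat_l with (r := T) in Hw'; [|lra].
      replace (T * (d / T)) with d in Hw' by (field; lra). exact Hw'. }
    specialize (K (RtoC t * h)%C ltac:(lra)).
    replace (B * T * M * (eps / (S + 1) * Cmod h)) with (B * (eps / (S + 1) * (T * Cmod h)) * M) by ring.
    apply Rmult_le_compat; [|apply Rabs_pos| |apply HM, Ht].
    { apply Rmult_le_pos; [left; apply exp_pos|apply Cmod_ge_0]. }
    apply Rmult_le_compat; [left; apply exp_pos|apply Cmod_ge_0| |].
    - apply exp_le. simpl. rewrite Rmult_0_l, Rminus_0_r.
      eapply Rle_trans; [apply Rle_abs|]. rewrite Rabs_mult.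
      apply Rmult_le_compat_r; [apply Rabs_pos|apply HT, Ht].
    - eapply Rle_trans; [apply K|]. apply Rmult_le_compat_l; lra. }
  eapply Rle_trans; [apply Fin|].
  replace ((b - a) * (B * T * M * (eps / (S + 1) * Cmod h))) with (S / (S + 1) * (eps * Cmod h))
    by (unfold S; field; fold S; lra).
  rewrite <- (Rmult_1_l (eps * Cmod h)) at 2.
  apply Rmult_le_compat_r; [apply Rmult_le_pos; lra|].
  apply Rmult_le_reg_r with (S + 1); [lra|]. unfold Rdiv. rewrite Rmult_assoc, Rinv_l; lra.
Qed.

Lemma is_derive_Rmult (f g : R -> R) (x df dg : R) :
  is_derive f x df -> is_derive g x dg -> is_derive (fun t => f t * g t) x (df * g x + f x * dg).
Proof.
  intros Hf Hg. apply is_derive_Reals in Hf, Hg. apply is_derive_Reals.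
  exact (derivable_pt_lim_mult f g x df dg Hf Hg).
Qed.

(** Integration by parts: [e^(t w) phi' + w e^(t w) phi] is the derivative of [phi e^(t w)], whose
    boundary values vanish. *)
Lemma laplace_derive (phi phi' : R -> R) (a b : R) (w : C) :
  (forall t, is_derive phi t (phi' t)) -> (forall t, continuous phi' t) ->
  phi a = 0 -> phi b = 0 ->
  laplace phi' a b w = (- (w * laplace phi a b w))%C.
Proof.
  intros Hd Hc Ha Hb.
  assert (Hphi : forall t, continuous phi t)
    by (intros t; apply (@ex_derive_continuous R_AbsRing R_NormedModule); exists (phi' t); apply Hd).
  set (e := fun t => cexp (RtoC t * w)%C).
  assert (He : forall t, is_derive (fun t => fst (e t)) t (fst (w * e t)%C) /\
                         is_derive (fun t => snd (e t)) t (snd (w * e t)%C)).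
  { intros t. apply (Cderive_path cexp (fun t => RtoC t * w)%C).
    - intros h. rewrite RtoC_plus; ring.
    - apply is_Cderive_cexp. }
  assert (HI : is_RIntC (fun t => plus (e t * RtoC (phi' t))%C (w * (e t * RtoC (phi t)))%C) a b
                 (minus (phi b * fst (e b)) (phi a * fst (e a)),
                  minus (phi b * snd (e b)) (phi a * snd (e a)))).
  { assert (Hc2 : forall t, @continuous R_UniformSpace C_UniformSpace
      (fun t => plus (e t * RtoC (phi' t))%C (w * (e t * RtoC (phi t)))%C) t).
    { intros t. apply (@continuous_plus R_UniformSpace R_AbsRing C_R_NormedModule).
      - apply continuous_laplace_integrand, Hc.
      - apply (continuous_comp (fun t => e t * RtoC (phi t))%C (fun z => w * z)%C).
        + apply continuous_laplace_integrand, Hphi.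
        + eapply Cderive_continuous, is_Cderive_scale. }
    apply (@is_RInt_fct_extend_pair R_NormedModule R_NormedModule).
    - apply (@is_RInt_derive R_CompleteNormedModule (fun t => phi t * fst (e t))).
      + intros t _. eapply eq_rect;
          [exact (is_derive_Rmult phi (fun t => fst (e t)) t _ _ (Hd t) (proj1 (He t)))|].
        unfold plus; simpl. ring.
      + intros t _. exact (continuous_comp _ fst t (Hc2 t) (continuous_fst _ _)).
    - apply (@is_RInt_derive R_CompleteNormedModule (fun t => phi t * snd (e t))).
      + intros t _. eapply eq_rect;
          [exact (is_derive_Rmult phi (fun t => snd (e t)) t _ _ (Hd t) (proj2 (He t)))|].
        unfold plus; simpl. ring.
      + intros t _. exact (continuous_comp _ snd t (Hc2 t) (continuous_snd _ _)). }
  assert (HJ := is_RInt_plus _ _ _ _ _ _ (is_RInt_laplace phi' a b Hc w)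
                  (is_RIntC_mult w _ _ _ _ (is_RInt_laplace phi a b Hphi w))).
  apply (@is_RInt_unique C_R_CompleteNormedModule) in HI.
  apply (@is_RInt_unique C_R_CompleteNormedModule) in HJ.
  assert (HK := eq_trans (eq_sym HJ) HI). rewrite Ha, Hb in HK.
  assert (Z : (laplace phi' a b w + w * laplace phi a b w = 0)%C).
  { etransitivity; [exact HK|]. unfold minus, plus, opp; simpl.
    apply f_equal2; ring. }
  replace (laplace phi' a b w) with
    (laplace phi' a b w + w * laplace phi a b w - w * laplace phi a b w)%C by ring.
  rewrite Z. ring.
Qed.

(** * The symbol and the test functions *)

(** The powers [|x|^g] and, below, [sgn(x) |x|^g]. Zero is a separate case because the total
    function [ln] would make the exponential equal to 1 there. *)
Definition abspow (g x : R) : R := if Req_EM_T x 0 then 0 else exp (g * ln (Rabs x)).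
Definition sgnpow (g x : R) : R := if Rlt_dec x 0 then - abspow g x else abspow g x.

Lemma abspow_pos (g x : R) : 0 <= abspow g x.
Proof. unfold abspow. destruct Req_EM_T; [lra|left; apply exp_pos]. Qed.

Lemma Rabs_sgnpow (g x : R) : Rabs (sgnpow g x) = abspow g x.
Proof.
  unfold sgnpow. assert (H := abspow_pos g x).
  destruct Rlt_dec; [rewrite Rabs_Ropp|]; apply Rabs_pos_eq, H.
Qed.

Lemma abspow_exp (g s : R) : abspow g (exp s) = exp (g * s).
Proof.
  unfold abspow. assert (H := exp_pos s). destruct Req_EM_T; [lra|].
  rewrite Rabs_pos_eq by lra. rewrite ln_exp; reflexivity.
Qed.

Lemma abspow_opp (g x : R) : abspow g (- x) = abspow g x.
Proof.
  unfold abspow. rewrite Rabs_Ropp. destruct (Req_EM_T (- x) 0), (Req_EM_T x 0); lra.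
Qed.

Lemma abspow_small (g eps : R) : 0 < g -> 0 < eps ->
  exists d, 0 < d /\ forall x, Rabs x < d -> abspow g x < eps.
Proof.
  intros Hg He. exists (exp (ln eps / g)). split; [apply exp_pos|]. intros x Hx.
  unfold abspow. destruct Req_EM_T as [|Hn]; [exact He|].
  rewrite <- (exp_ln eps) by exact He. apply exp_increasing.
  assert (H : ln (Rabs x) < ln eps / g).
  { rewrite <- (ln_exp (ln eps / g)). apply ln_increasing; [apply Rabs_pos_lt, Hn|exact Hx]. }
  apply Rmult_lt_compat_l with (r := g) in H; [|exact Hg].
  replace (g * (ln eps / g)) with (ln eps) in H by (field; lra). exact H.
Qed.

Lemma continuous_at_0_of_abspow (g : R) (f : R -> R) : 0 < g ->
  f 0 = 0 -> (forall x, Rabs (f x) = abspow g x) -> continuous f 0.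
Proof.
  intros Hg H0 Hf P [e He]. destruct (abspow_small g e Hg (cond_pos e)) as [d [Hd Hs]].
  exists (mkposreal d Hd). intros x Hx. apply He. rewrite H0.
  unfold ball; simpl; unfold AbsRing_ball, abs, minus, plus, opp; simpl.
  rewrite Ropp_0, Rplus_0_r, Hf. apply Hs.
  unfold ball in Hx; simpl in Hx; unfold AbsRing_ball, abs, minus, plus, opp in Hx; simpl in Hx.
  rewrite Ropp_0, Rplus_0_r in Hx. exact Hx.
Qed.

Lemma abspow_continuous (g x : R) : 0 < g -> continuous (abspow g) x.
Proof.
  intros Hg. destruct (Req_dec x 0) as [->|Hn].
  - apply (continuous_at_0_of_abspow g); [exact Hg| |intros; apply Rabs_pos_eq, abspow_pos].
    unfold abspow; destruct Req_EM_T; lra.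
  - apply (continuous_ext_loc _ (fun y => exp (g * ln (Rabs y)))).
    + exists (mkposreal _ (Rabs_pos_lt x Hn)). intros y Hy. unfold abspow.
      destruct Req_EM_T as [->|]; [|reflexivity]. exfalso.
      unfold ball in Hy; simpl in Hy; unfold AbsRing_ball, abs, minus, plus, opp in Hy; simpl in Hy.
      rewrite Rplus_0_l, Rabs_Ropp in Hy. lra.
    + apply (continuous_comp (fun y => g * ln (Rabs y)) exp); [|apply continuous_exp].
      apply (continuous_scal_r g (fun y => ln (Rabs y))).
      apply (continuous_comp Rabs ln); [apply continuous_Rabs|].
      apply continuous_ln, Rabs_pos_lt, Hn.
Qed.

Lemma sgnpow_continuous (g x : R) : 0 < g -> continuous (sgnpow g) x.
Proof.
  intros Hg. destruct (Rtotal_order x 0) as [H|[->|H]].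
  - apply (continuous_ext_loc _ (fun y => - abspow g y)).
    + assert (Hx : 0 < - x) by lra. exists (mkposreal _ Hx). intros y Hy. apply Rabs_def2 in Hy.
      unfold minus, plus, opp in Hy; simpl in Hy. unfold sgnpow. destruct Rlt_dec; lra.
    + apply (continuous_opp (abspow g)), abspow_continuous, Hg.
  - apply (continuous_at_0_of_abspow g); [exact Hg| |intros; apply Rabs_sgnpow].
    unfold sgnpow, abspow; destruct Rlt_dec, Req_EM_T; lra.
  - apply (continuous_ext_loc _ (fun y => abspow g y)).
    + exists (mkposreal _ H). intros y Hy. apply Rabs_def2 in Hy.
      unfold minus, plus, opp in Hy; simpl in Hy. unfold sgnpow. destruct Rlt_dec; lra.
    + apply abspow_continuous, Hg.
Qed.

Lemma norm3_pos (x : R * R * R) : 0 <= norm3 x.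
Proof. destruct x as [[x1 x2] x3]. apply sqrt_pos. Qed.

(** The principal argument of [-i w] is [- sgn(w) pi / 2], so the even power carries the cosine and
    the odd power the sine. At [w = 0] both powers vanish, in accordance with [cpow]. *)
Lemma symbol_eq (alpha0 g : R) (x : R * R * R) (w : R) :
  let k := alpha_tilde alpha0 g * norm3 x in
  symbol alpha0 g x w =
  cexp (- (k * cos (PI / 2 * g) * abspow g w), k * sin (PI / 2 * g) * sgnpow g w).
Proof.
  intros k. unfold symbol. f_equal. unfold alpha_pl, cpow.
  assert (HC : Cmod (0, - w) = Rabs w).
  { unfold Cmod; simpl. rewrite <- (Rabs_Ropp w), <- sqrt_Rsqr_abs. f_equal. unfold Rsqr; ring. }
  rewrite HC. unfold sgnpow, abspow.
  destruct (Req_EM_T (Rabs w) 0) as [E|E], (Req_EM_T w 0) as [E'|E'].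
  - destruct Rlt_dec; unfold Copp, Cmult, RtoC; simpl; apply f_equal2; ring.
  - exfalso; apply (Rabs_no_R0 w E' E).
  - exfalso; apply E; rewrite E'; apply Rabs_R0.
  - unfold carg; simpl. destruct (Rlt_dec 0 0); [lra|]. unfold k.
    destruct (Rlt_dec 0 (- w)), (Rlt_dec w 0); try lra;
      unfold cexp, Copp, Cmult, RtoC; simpl.
    + rewrite (Rmult_comm g (PI / 2)). apply f_equal2; ring.
    + replace (g * - (PI / 2)) with (- (PI / 2 * g)) by ring. rewrite cos_neg, sin_neg.
      apply f_equal2; ring.
Qed.

Lemma symbol_continuous (alpha0 g : R) (x : R * R * R) (w : R) : 0 < g ->
  @continuous R_UniformSpace C_UniformSpace (symbol alpha0 g x) w.
Proof.
  intros Hg.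
  apply (continuous_ext (fun w => cexp (- (alpha_tilde alpha0 g * norm3 x * cos (PI / 2 * g) * abspow g w),
     alpha_tilde alpha0 g * norm3 x * sin (PI / 2 * g) * sgnpow g w)));
    [intros; symmetry; apply symbol_eq|].
  apply (continuous_comp (fun w => (- (alpha_tilde alpha0 g * norm3 x * cos (PI / 2 * g) * abspow g w),
     alpha_tilde alpha0 g * norm3 x * sin (PI / 2 * g) * sgnpow g w)) cexp).
  - apply continuous_C_pair; simpl.
    + apply (continuous_opp (fun w => alpha_tilde alpha0 g * norm3 x * cos (PI / 2 * g) * abspow g w)).
      apply (continuous_scal_r _ (abspow g)), abspow_continuous, Hg.
    + apply (continuous_scal_r _ (sgnpow g)), sgnpow_continuous, Hg.
  - eapply Cderive_continuous, is_Cderive_cexp.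
Qed.

(** The cosine in the denominator of [alpha_tilde] cancels, leaving a decay rate governed by
    [alpha0] even where [alpha_tilde] is negative. *)
Lemma Cmod_symbol (alpha0 g : R) (x : R * R * R) (w : R) :
  cos (PI / 2 * g) <> 0 ->
  Cmod (symbol alpha0 g x w) = exp (- (alpha0 * norm3 x * abspow g w)).
Proof.
  intros Hc. rewrite symbol_eq, Cmod_cexp. simpl. f_equal. unfold alpha_tilde. field. exact Hc.
Qed.

Lemma smooth_is_derive (phi : R -> R) : smooth phi -> forall t, is_derive phi t (Derive phi t).
Proof. intros H t. apply Derive_correct. apply (H 1%nat t). Qed.

Lemma smooth_continuous (phi : R -> R) : smooth phi -> forall t, continuous phi t.
Proof.
  intros H t. apply (@ex_derive_continuous R_AbsRing R_NormedModule). exact (H 1%nat t).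
Qed.

Lemma Derive_n_Derive (f : R -> R) (n : nat) (t : R) : Derive_n (Derive f) n t = Derive_n f (S n) t.
Proof. rewrite <- Nat.add_1_r, <- (Derive_n_comp f n 1). reflexivity. Qed.

Lemma smooth_Derive (phi : R -> R) : smooth phi -> smooth (Derive phi).
Proof.
  intros H [|n] t; [exact I|]. simpl.
  apply (ex_derive_ext (Derive_n phi (S n))); [intros; symmetry; apply Derive_n_Derive|].
  exact (H (S (S n)) t).
Qed.

Definition supported (phi : R -> R) (a b : R) := forall t, t < a \/ b < t -> phi t = 0.

Lemma supported_Derive (phi : R -> R) (a b : R) : supported phi a b -> supported (Derive phi) a b.
Proof.
  intros H t Ht. rewrite (Derive_ext_loc _ (fun _ => 0)); [apply Derive_const|].
  destruct Ht as [Ht|Ht]; [assert (d : 0 < a - t) by lra|assert (d : 0 < t - b) by lra];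
    exists (mkposreal _ d); intros y Hy; apply Rabs_def2 in Hy;
    unfold minus, plus, opp in Hy; simpl in Hy; apply H; [left|right]; lra.
Qed.

(** [supported] speaks only of points strictly outside the segment; continuity supplies the endpoint
    values that integration by parts calls for. *)
Lemma supported_endpoints (phi : R -> R) (a b : R) :
  (forall t, continuous phi t) -> supported phi a b -> phi a = 0 /\ phi b = 0.
Proof.
  intros Hc H.
  assert (K : forall x, (forall d, 0 < d -> exists y, Rabs (y - x) < d /\ phi y = 0) -> phi x = 0).
  { intros x Hx. destruct (Req_dec (phi x) 0) as [|Hn]; [assumption|exfalso].
    assert (P := Rabs_pos_lt _ Hn).
    destruct (Hc x (fun z => Rabs (z - phi x) < Rabs (phi x))) as [d Hd].
    - exists (mkposreal _ P). intros z Hz; exact Hz.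
    - destruct (Hx d (cond_pos d)) as [y [Hy1 Hy2]]. specialize (Hd y Hy1). simpl in Hd.
      rewrite Hy2, Rminus_0_l, Rabs_Ropp in Hd. lra. }
  split; apply K; intros d Hd.
  - exists (a - d / 2). split; [rewrite Rabs_left; lra|apply H; lra].
  - exists (b + d / 2). split; [rewrite Rabs_right; lra|apply H; lra].
Qed.

Lemma laplace_Derive (phi : R -> R) (a b : R) (w : C) :
  smooth phi -> supported phi a b ->
  laplace (Derive phi) a b w = (- (w * laplace phi a b w))%C.
Proof.
  intros Hs Hsup. destruct (supported_endpoints phi a b (smooth_continuous _ Hs) Hsup).
  apply laplace_derive; try assumption.
  - apply smooth_is_derive, Hs.
  - apply smooth_continuous, smooth_Derive, Hs.
Qed.

(** The trivial bound is applied to [phi] and to its second derivative, whose transform is [w^2]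
    times that of [phi]. Summing the two constants gives one [M] for both estimates. *)
Lemma laplace_decay (phi : R -> R) (a b : R) :
  smooth phi -> supported phi a b -> a <= b -> b <= 0 ->
  exists M, 0 <= M /\ forall w, 0 <= fst w ->
    Cmod (laplace phi a b w) <= M /\ Cmod w ^ 2 * Cmod (laplace phi a b w) <= M.
Proof.
  intros Hs Hsup Hab Hb.
  assert (Hs1 := smooth_Derive _ Hs). assert (Hs2 := smooth_Derive _ Hs1).
  assert (Hsup1 := supported_Derive _ _ _ Hsup).
  destruct (bounded_on_segment phi a b (smooth_continuous _ Hs) Hab) as [M0 [P0 H0]].
  destruct (bounded_on_segment _ a b (smooth_continuous _ Hs2) Hab) as [M2 [P2 H2]].
  exists ((b - a) * M0 + (b - a) * M2).
  assert (0 <= (b - a) * M0) by (apply Rmult_le_pos; lra).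
  assert (0 <= (b - a) * M2) by (apply Rmult_le_pos; lra).
  split; [lra|]. intros w Hw.
  assert (A := Cmod_laplace_le phi a b (smooth_continuous _ Hs) w M0 Hab Hb Hw H0).
  assert (B := Cmod_laplace_le _ a b (smooth_continuous _ Hs2) w M2 Hab Hb Hw H2).
  split; [lra|].
  rewrite (laplace_Derive (Derive phi)), (laplace_Derive phi) in B by assumption.
  rewrite Cmod_opp, Cmod_mult, Cmod_opp, Cmod_mult in B.
  replace (Cmod w ^ 2 * Cmod (laplace phi a b w)) with
    (Cmod w * (Cmod w * Cmod (laplace phi a b w))) by ring. lra.
Qed.

(** * Causality for exponents less than one *)

(** The product [m Phi], that is, the integrand of [K_causal] stripped of its two factors
    [1 / sqrt (2 pi)]. *)
Definition spectrum (alpha0 g : R) (x : R * R * R) (phi : R -> R) (a b w : R) : C :=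
  (symbol alpha0 g x w * laplace phi a b (0, (- w)%R))%C.

Lemma inv_ft_test_eq (phi : R -> R) (a b w : R) :
  inv_ft_test phi a b w = @scal R_AbsRing C_R_NormedModule (/ sqrt (2 * PI)) (laplace phi a b (0, - w)).
Proof.
  unfold inv_ft_test, laplace. f_equal. apply (@RInt_ext C_R_CompleteNormedModule).
  intros t _. f_equal. f_equal. unfold Cmult, RtoC; simpl. apply f_equal2; ring.
Qed.

Lemma scal_R_Cmult (r : R) (z : C) : @scal R_AbsRing C_R_NormedModule r z = (RtoC r * z)%C.
Proof.
  destruct z as [u v]. unfold scal; simpl. unfold prod_scal, scal; simpl. unfold mult; simpl.
  unfold Cmult, RtoC; simpl. apply f_equal2; ring.
Qed.

Lemma K_integrand_eq (alpha0 g : R) (x : R * R * R) (phi : R -> R) (a b w : R) :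
  @scal R_AbsRing C_R_NormedModule (/ sqrt (2 * PI)) (Cmult (symbol alpha0 g x w) (inv_ft_test phi a b w))
  = (RtoC (/ (2 * PI)) * spectrum alpha0 g x phi a b w)%C.
Proof.
  rewrite inv_ft_test_eq. unfold spectrum.
  assert (E : / (2 * PI) = / sqrt (2 * PI) * / sqrt (2 * PI)).
  { rewrite <- Rinv_mult, sqrt_sqrt; [reflexivity|]. assert (H := PI_RGT_0); lra. }
  rewrite E, RtoC_mult, !scal_R_Cmult.
  match goal with |- ?u = ?v => change (@eq C u v) end. ring.
Qed.

Lemma laplace_imag_continuous (phi : R -> R) (a b w : R) :
  (forall t, continuous phi t) -> a <= b ->
  @continuous R_UniformSpace C_UniformSpace (fun w => laplace phi a b (0, - w)) w.
Proof.
  intros Hc Hab. apply (continuous_comp (fun w => (0, - w) : C) (laplace phi a b)).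
  - apply continuous_C_pair; simpl; [apply continuous_const|].
    apply (@continuous_opp R_UniformSpace R_AbsRing R_NormedModule (fun w => w)), continuous_id.
  - eapply Cderive_continuous, is_Cderive_laplace; assumption.
Qed.

Lemma continuous_C_mult (f g : R -> C) (t : R) :
  @continuous R_UniformSpace C_UniformSpace f t -> @continuous R_UniformSpace C_UniformSpace g t ->
  @continuous R_UniformSpace C_UniformSpace (fun s => (f s * g s)%C) t.
Proof.
  intros Hf Hg.
  assert (M : forall f g : R -> R, continuous f t -> continuous g t -> continuous (fun s => f s * g s) t)
    by (intros f' g'; apply (@continuous_mult R_UniformSpace R_AbsRing)).
  assert (F1 := continuous_comp f fst t Hf (continuous_fst _ _)).
  assert (F2 := continuous_comp f snd t Hf (continuous_snd _ _)).
  assert (G1 := continuous_comp g fst t Hg (continuous_fst _ _)).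
  assert (G2 := continuous_comp g snd t Hg (continuous_snd _ _)).
  apply continuous_C_pair; simpl.
  - apply (@continuous_minus R_UniformSpace R_AbsRing R_NormedModule
      (fun s => fst (f s) * fst (g s)) (fun s => snd (f s) * snd (g s))); apply M; assumption.
  - apply (@continuous_plus R_UniformSpace R_AbsRing R_NormedModule
      (fun s => fst (f s) * snd (g s)) (fun s => snd (f s) * fst (g s))); apply M; assumption.
Qed.

Lemma spectrum_continuous (alpha0 g : R) (x : R * R * R) (phi : R -> R) (a b w : R) :
  0 < g -> (forall t, continuous phi t) -> a <= b ->
  @continuous R_UniformSpace C_UniformSpace (spectrum alpha0 g x phi a b) w.
Proof.
  intros Hg Hc Hab. apply continuous_C_mult.
  - apply symbol_continuous, Hg.
  - apply laplace_imag_continuous; assumption.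
Qed.

(** The two endpoints go to infinity independently, so the hypothesis must cover unsymmetric
    intervals [[A, B]] and not only [[-N, N]]. *)
Lemma is_RInt_gen_of_bound (G : R -> C) (c M : R) :
  (forall t, @continuous R_UniformSpace C_UniformSpace G t) ->
  (forall A B N, 0 < N -> A <= - N -> N <= B -> Cmod (RIntC G A B) <= M / N) ->
  @is_RInt_gen C_R_NormedModule (fun w => (RtoC c * G w)%C)
    (Rbar_locally m_infty) (Rbar_locally p_infty) (RtoC 0).
Proof.
  intros Hc HM P [e He].
  set (N := (Rabs c * Rabs M + 1) / e).
  assert (P1 : 0 <= Rabs c * Rabs M) by (apply Rmult_le_pos; apply Rabs_pos).
  assert (He' := cond_pos e).
  assert (HN : 0 < N) by (apply Rdiv_lt_0_compat; lra).
  apply (Filter_prod _ _ _ (fun A => A < - N) (fun B => N < B)).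
  - exists (- N). intros; assumption.
  - exists N. intros; assumption.
  - intros A B HA HB. exists (RtoC c * RIntC G A B)%C. split.
    + apply is_RIntC_mult, is_RIntC_continuous, Hc.
    + apply He.
      assert (L : Cmod (RtoC c * RIntC G A B) < e).
      { rewrite Cmod_mult, Cmod_R.
        apply Rle_lt_trans with (Rabs c * (Rabs M / N)).
        - apply Rmult_le_compat_l; [apply Rabs_pos|].
          eapply Rle_trans; [apply (HM A B N); lra|].
          apply Rmult_le_compat_r; [left; apply Rinv_0_lt_compat, HN|apply Rle_abs].
        - replace (Rabs c * (Rabs M / N)) with (Rabs c * Rabs M / (Rabs c * Rabs M + 1) * e)
            by (unfold N; field; split; lra).
          rewrite <- (Rmult_1_l e) at 2. apply Rmult_lt_compat_r; [exact He'|].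
          apply Rmult_lt_reg_r with (Rabs c * Rabs M + 1); [lra|].
          unfold Rdiv. rewrite Rmult_assoc, Rinv_l; lra. }
      assert (L1 := fst_le_Cmod (RtoC c * RIntC G A B)).
      assert (L2 := snd_le_Cmod (RtoC c * RIntC G A B)).
      split; unfold ball; simpl; unfold AbsRing_ball, abs, minus, plus, opp; simpl;
        rewrite Ropp_0, Rplus_0_r; simpl in L1, L2; lra.
Qed.

Section Sufficiency.
Variables (alpha0 g : R) (x : R * R * R) (phi : R -> R) (a b : R).
Hypotheses (Halpha : 0 < alpha0) (Hg : 0 < g < 1).
Hypotheses (Hs : smooth phi) (Hsup : supported phi a b) (Hab : a <= b) (Hb : b <= 0).

Let k := alpha_tilde alpha0 g * norm3 x.
Let G := spectrum alpha0 g x phi a b.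
(* [F] is the integrand in the variable [z] with [w = i e^z]; the factor [Ci * cexp z] is [dw/dz]. *)
Let expo (z : C) : C := (z + RtoC (- k) * cexp (RtoC g * z))%C.
Let F (z : C) : C := (Ci * (cexp (expo z) * laplace phi a b (cexp z)))%C.
Let F' (z : C) : C :=
  (Ci * (((1 + RtoC g * cexp (RtoC g * z) * RtoC (- k)) * cexp (expo z)) * laplace phi a b (cexp z)
    + cexp (expo z) * (cexp z * laplace (fun t => (t * phi t)%R) a b (cexp z))))%C.

Lemma is_Cderive_ext_val (f : C -> C) (z l l' : C) : is_Cderive f z l -> l = l' -> is_Cderive f z l'.
Proof. intros H <-; exact H. Qed.

Lemma is_Cderive_expo z :
  is_Cderive expo z (1 + RtoC g * cexp (RtoC g * z) * RtoC (- k))%C.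
Proof.
  apply is_Cderive_plus; [apply (@is_derive_id C_AbsRing)|].
  apply (is_Cderive_comp (fun w => RtoC (- k) * w)%C (fun z => cexp (RtoC g * z))%C); [apply is_Cderive_scale|].
  apply (is_Cderive_comp cexp (fun z => RtoC g * z)%C); [apply is_Cderive_cexp|apply is_Cderive_scale].
Qed.

Lemma is_Cderive_F z : is_Cderive F z (F' z).
Proof.
  assert (Hc := smooth_continuous _ Hs).
  unfold F, F'. eapply is_Cderive_ext_val; [|apply Cmult_comm].
  apply (is_Cderive_comp (fun w => Ci * w)%C (fun z => cexp (expo z) * laplace phi a b (cexp z))%C);
    [apply is_Cderive_scale|].
  apply (is_Cderive_mult (fun z => cexp (expo z)) (fun z => laplace phi a b (cexp z))).
  - apply (is_Cderive_comp cexp expo); [apply is_Cderive_cexp|apply is_Cderive_expo].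
  - apply (is_Cderive_comp (laplace phi a b) cexp); [apply is_Cderive_laplace; assumption|apply is_Cderive_cexp].
Qed.

(** [F'] is built from exponentials and Laplace transforms, hence is itself complex differentiable;
    this gives continuity without a componentwise check. *)
Lemma continuous_F' z : @continuous C_UniformSpace C_UniformSpace F' z.
Proof.
  assert (Hc := smooth_continuous _ Hs).
  assert (Hc1 : forall t, continuous (fun t => t * phi t) t).
  { intros t. apply (@continuous_mult R_UniformSpace R_AbsRing); [apply continuous_id|apply Hc]. }
  assert (exists l, is_Cderive F' z l) as [l Hl]; [|eapply Cderive_continuous, Hl].
  assert (De : is_Cderive (fun z => cexp (expo z)) z _)
    by (apply (is_Cderive_comp cexp expo); [apply is_Cderive_cexp|apply is_Cderive_expo]).
  assert (D1 : is_Cderive (fun z => 1 + RtoC g * cexp (RtoC g * z) * RtoC (- k))%C z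
     (0 + ((RtoC g * cexp (RtoC g * z)) * RtoC g) * RtoC (- k))%C).
  { apply is_Cderive_plus; [apply (@is_derive_const C_AbsRing)|].
    apply (is_Cderive_ext_val _ _ (((RtoC g * cexp (RtoC g * z)) * RtoC g) * RtoC (- k)
       + RtoC g * cexp (RtoC g * z) * 0)%C); [|ring].
    apply (is_Cderive_mult (fun z => RtoC g * cexp (RtoC g * z))%C (fun _ => RtoC (- k)));
      [|apply (@is_derive_const C_AbsRing)].
    apply (is_Cderive_comp (fun w => RtoC g * w)%C (fun z => cexp (RtoC g * z))%C); [apply is_Cderive_scale|].
    apply (is_Cderive_comp cexp (fun z => RtoC g * z)%C); [apply is_Cderive_cexp|apply is_Cderive_scale]. }
  eexists.
  apply (is_Cderive_comp (fun w => Ci * w)%C); [apply is_Cderive_scale|].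
  apply is_Cderive_plus.
  - apply is_Cderive_mult; [apply is_Cderive_mult; [exact D1|exact De]|].
    apply (is_Cderive_comp (laplace phi a b) cexp); [apply is_Cderive_laplace; assumption|apply is_Cderive_cexp].
  - apply is_Cderive_mult; [exact De|]. apply is_Cderive_mult; [apply is_Cderive_cexp|].
    apply (is_Cderive_comp (laplace _ a b) cexp); [apply is_Cderive_laplace; assumption|apply is_Cderive_cexp].
Qed.

Lemma cos_half_pi_pos : 0 < cos (PI / 2 * g).
Proof. assert (H := PI_RGT_0). apply cos_gt_0; nra. Qed.

Lemma k_pos : 0 <= k.
Proof.
  unfold k, alpha_tilde. apply Rmult_le_pos; [|apply norm3_pos].
  left. apply Rdiv_lt_0_compat; [exact Halpha|exact cos_half_pi_pos].
Qed.

(** On this edge [w = i e^z] equals [e^s], the positive half-axis; on the upper edge, treated next,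
    [w = - e^s]. The real factor in front of [G] is [dw/ds]. *)
Lemma F_lower (s : R) : F (s, - (PI / 2)) = (RtoC (exp s) * G (exp s))%C.
Proof.
  unfold F, G, spectrum, expo. rewrite symbol_eq. fold k.
  assert (E0 : cexp (s, - (PI / 2)) = (0, - exp s)).
  { unfold cexp; simpl. rewrite cos_neg, sin_neg, cos_PI2, sin_PI2. apply f_equal2; ring. }
  rewrite cexp_plus, E0.
  replace (RtoC (- k) * cexp (RtoC g * (s, (- (PI / 2))%R)))%C with
    ((- (k * cos (PI / 2 * g) * abspow g (exp s)), k * sin (PI / 2 * g) * sgnpow g (exp s)) : C).
  - replace (Ci * ((0, (- exp s)%R) * _ * _))%C with
      ((Ci * (0, (- exp s)%R)) * cexp ((- (k * cos (PI / 2 * g) * abspow g (exp s)))%R, (k * sin (PI / 2 * g) * sgnpow g (exp s))%R)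
        * laplace phi a b (0, (- exp s)%R))%C by ring.
    replace (Ci * (0, (- exp s)%R))%C with (RtoC (exp s)) by (unfold Ci, Cmult, RtoC; simpl; apply f_equal2; ring).
    ring.
  - unfold sgnpow. assert (P := exp_pos s). destruct Rlt_dec; [lra|]. rewrite abspow_exp.
    unfold cexp, Cmult, RtoC; simpl.
    replace (g * - (PI / 2) + 0 * s) with (- (PI / 2 * g)) by ring.
    replace (g * s - 0 * - (PI / 2)) with (g * s) by ring.
    rewrite cos_neg, sin_neg. apply f_equal2; ring.
Qed.

Lemma F_upper (s : R) : F (s, PI / 2) = (RtoC (- exp s) * G (- exp s))%C.
Proof.
  unfold F, G, spectrum, expo. rewrite symbol_eq. fold k.
  assert (E0 : cexp (s, PI / 2) = (0, - - exp s)).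
  { unfold cexp; simpl. rewrite cos_PI2, sin_PI2. apply f_equal2; ring. }
  rewrite cexp_plus, E0.
  replace (RtoC (- k) * cexp (RtoC g * (s, (PI / 2)%R)))%C with
    ((- (k * cos (PI / 2 * g) * abspow g (- exp s)), k * sin (PI / 2 * g) * sgnpow g (- exp s)) : C).
  - replace (Ci * ((0, (- - exp s)%R) * _ * _))%C with
      ((Ci * (0, (- - exp s)%R)) * cexp ((- (k * cos (PI / 2 * g) * abspow g (- exp s)))%R, (k * sin (PI / 2 * g) * sgnpow g (- exp s))%R)
        * laplace phi a b (0, (- - exp s)%R))%C by ring.
    replace (Ci * (0, (- - exp s)%R))%C with (RtoC (- exp s)) by (unfold Ci, Cmult, RtoC; simpl; apply f_equal2; ring).
    ring.
  - unfold sgnpow. assert (P := exp_pos s). destruct Rlt_dec; [|lra]. rewrite abspow_opp, abspow_exp.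
    unfold cexp, Cmult, RtoC; simpl.
    replace (g * (PI / 2) + 0 * s) with (PI / 2 * g) by ring.
    replace (g * s - 0 * (PI / 2)) with (g * s) by ring.
    apply f_equal2; ring.
Qed.

(** On the strip [|g t| <= pi/2], hence [e^(g z)] has nonnegative real part and [e^(- k e^(g z))]
    has modulus at most 1. What remains is [e^s], the size of [dw/dz]. *)
Lemma Cmod_F_le (s t : R) : - (PI / 2) <= t <= PI / 2 ->
  0 <= fst (cexp (s, t)) /\ Cmod (F (s, t)) <= exp s * Cmod (laplace phi a b (cexp (s, t))).
Proof.
  intros Ht. split.
  - simpl. apply Rmult_le_pos; [left; apply exp_pos|]. apply cos_ge_0; lra.
  - unfold F. rewrite !Cmod_mult, Cmod_Ci, Rmult_1_l, Cmod_cexp.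
    apply Rmult_le_compat_r; [apply Cmod_ge_0|].
    assert (K := k_pos). assert (P := exp_pos (g * s - 0 * t)).
    assert (Q : 0 <= cos (g * t + 0 * s)) by (assert (Hpi := PI_RGT_0); apply cos_ge_0; nra).
    apply exp_le. unfold expo; simpl.
    assert (0 <= exp (g * s - 0 * t) * cos (g * t + 0 * s)) by (apply Rmult_le_pos; lra).
    nra.
Qed.

Lemma Cmod_G_le (M : R) :
  (forall w, 0 <= fst w -> Cmod (laplace phi a b w) <= M /\ Cmod w ^ 2 * Cmod (laplace phi a b w) <= M) ->
  forall w, Cmod (G w) <= M /\ w ^ 2 * Cmod (G w) <= M.
Proof.
  intros HM w. destruct (HM (0, - w)) as [A B]; [simpl; lra|].
  assert (HC : Cmod (0, - w) ^ 2 = w ^ 2).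
  { rewrite Cmod2_alt. unfold Re, Im; simpl. ring. }
  rewrite HC in B. unfold G, spectrum. rewrite Cmod_mult.
  assert (C0 := cos_half_pi_pos).
  rewrite Cmod_symbol by lra.
  assert (S0 : exp (- (alpha0 * norm3 x * abspow g w)) <= 1).
  { rewrite <- exp_0. apply exp_le.
    assert (0 <= alpha0 * norm3 x * abspow g w); [|lra].
    apply Rmult_le_pos; [apply Rmult_le_pos; [lra|apply norm3_pos]|apply abspow_pos]. }
  assert (S1 := exp_pos (- (alpha0 * norm3 x * abspow g w))).
  assert (L := Cmod_ge_0 (laplace phi a b (0, - w))).
  assert (exp (- (alpha0 * norm3 x * abspow g w)) * Cmod (laplace phi a b (0, - w)) <= Cmod (laplace phi a b (0, - w)))
    by (rewrite <- (Rmult_1_l (Cmod _)) at 2; apply Rmult_le_compat_r; lra).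
  assert (0 <= w ^ 2) by nra.
  split; [lra|]. eapply Rle_trans; [|exact B]. apply Rmult_le_compat_l; lra.
Qed.

Lemma G_continuous w : @continuous R_UniformSpace C_UniformSpace G w.
Proof. apply spectrum_continuous; [lra|apply smooth_continuous, Hs|exact Hab]. Qed.

Lemma RIntC_G_exp (u v : R) : RIntC (fun s => F (s, - (PI / 2))) u v = RIntC G (exp u) (exp v).
Proof.
  apply (@is_RInt_unique C_R_CompleteNormedModule).
  apply (is_RInt_ext (fun s => @scal R_AbsRing C_R_NormedModule (exp s) (G (exp s)))).
  - intros s _. rewrite F_lower. apply scal_R_Cmult.
  - apply (@is_RInt_comp C_R_CompleteNormedModule G exp exp).
    + intros; apply G_continuous.
    + intros; split; [apply is_derive_exp|apply continuous_exp].
Qed.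

Lemma RIntC_G_opp_exp (u v : R) : RIntC (fun s => F (s, PI / 2)) u v = RIntC G (- exp u) (- exp v).
Proof.
  apply (@is_RInt_unique C_R_CompleteNormedModule).
  apply (is_RInt_ext (fun s => @scal R_AbsRing C_R_NormedModule (- exp s) (G (- exp s)))).
  - intros s _. rewrite F_upper. apply scal_R_Cmult.
  - apply (@is_RInt_comp C_R_CompleteNormedModule G (fun s => - exp s) (fun s => - exp s)).
    + intros; apply G_continuous.
    + intros s _; split.
      * apply (is_derive_opp exp), is_derive_exp.
      * apply (@continuous_opp R_UniformSpace R_AbsRing R_NormedModule exp), continuous_exp.
Qed.

Lemma RIntC_Chasles (u v w : R) : RIntC G u w = (RIntC G u v + RIntC G v w)%C.
Proof.
  symmetry. apply (@RInt_Chasles C_R_CompleteNormedModule);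
    apply (@ex_RInt_continuous C_R_CompleteNormedModule); intros z _; apply G_continuous.
Qed.

Lemma RIntC_swap (u v : R) : RIntC G u v = (- RIntC G v u)%C.
Proof. symmetry. apply (@opp_RInt_swap C_R_CompleteNormedModule).
    apply (@ex_RInt_continuous C_R_CompleteNormedModule); intros z _; apply G_continuous. Qed.

(** Comparison with [M / w^2], whose antiderivative is [M / - w]. Negative tails are enough because
    the rectangle will be fitted to the right endpoint. *)
Lemma tail_le (M u v : R) :
  (forall w, w ^ 2 * Cmod (G w) <= M) -> 0 <= M -> u <= v -> v < 0 ->
  Cmod (RIntC G u v) <= M / - v.
Proof.
  intros HM M0 Huv Hv. rewrite <- norm_R_Cmod.
  apply Rle_trans with (M / - v - M / - u).
  - apply (norm_RInt_le G (fun w => M / w ^ 2) u v _ _ Huv).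
    + intros w Hw. rewrite norm_R_Cmod. apply Rmult_le_reg_l with (w ^ 2); [nra|].
      replace (w ^ 2 * (M / w ^ 2)) with M by (field; nra). apply HM.
    + apply is_RIntC_continuous, G_continuous.
    + apply (@is_RInt_derive R_CompleteNormedModule (fun w => M / - w)).
      * intros w Hw. rewrite Rmin_left, Rmax_right in Hw by lra. auto_derive; [lra|field; lra].
      * intros w Hw. rewrite Rmin_left, Rmax_right in Hw by lra.
        apply (@ex_derive_continuous R_AbsRing R_NormedModule). auto_derive. nra.
  - assert (0 <= M / - u); [|lra]. apply Rmult_le_pos; [lra|]. left; apply Rinv_0_lt_compat; lra.
Qed.

(** The rectangle is fitted to [B], which leaves two pieces of [[A, B]]: the gap [|w| <= 1/B] and
    the interval between [A] and [-B]. For [B < 1] the same oriented identities hold with the sides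
    run backwards. *)
Lemma spectrum_integral_bound : exists M, forall A B N, 0 < N -> A <= - N -> N <= B ->
  Cmod (RIntC G A B) <= M / N.
Proof.
  destruct (laplace_decay phi a b Hs Hsup Hab Hb) as [M [M0 HM]].
  assert (HG := Cmod_G_le M HM).
  assert (Hpi := PI_RGT_0).
  (* [4 * PI * M] comes from the rectangle, [2 * M] from the gap around 0, and [M] from the tail. *)
  exists (4 * PI * M + 3 * M). intros A B N HN HA HB.
  set (L := ln B).
  assert (EB : exp L = B) by (apply exp_ln; lra).
  assert (Ee : exp (- L) = / B) by (rewrite exp_Ropp, EB; reflexivity).
  assert (HIB : 0 < / B) by (apply Rinv_0_lt_compat; lra).
  assert (HBN : / B <= / N) by (apply Rinv_le_contravar; lra).
  assert (Rect : Cmod (RIntC (fun s => F (s, PI / 2)) (- L) L - RIntC (fun s => F (s, - (PI / 2))) (- L) L)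
    <= 2 * (2 * M * / B * (PI / 2 - - (PI / 2)))).
  { apply (cauchy_rectangle F F'); [apply is_Cderive_F|apply continuous_F'|lra|].
    intros t Ht.
    (* Both vertical sides are at most [M / B]: on the right [e^L = B] meets the decay [M / B^2], on
       the left [e^(-L) = 1/B] meets the plain bound [M]. *)
    destruct (Cmod_F_le L t Ht) as [A1 A2]. destruct (Cmod_F_le (- L) t Ht) as [B1 B2].
    destruct (HM _ A1) as [_ A3]. destruct (HM _ B1) as [B3 _].
    rewrite Cmod_cexp in A3. simpl fst in A3. rewrite EB in A2, A3. rewrite Ee in B2.
    set (l := Cmod (laplace phi a b (cexp (L, t)))) in *.
    assert (B * l <= M * / B).
    { apply Rmult_le_reg_l with B; [lra|]. replace (B * (M * / B)) with M by (field; lra). nra. }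
    assert (/ B * Cmod (laplace phi a b (cexp (- L, t))) <= / B * M) by (apply Rmult_le_compat_l; lra).
    lra. }
  rewrite RIntC_G_exp, RIntC_G_opp_exp, EB, Ee in Rect.
  assert (Mid : Cmod (RIntC G (- / B) (/ B)) <= (/ B - - / B) * M).
  { apply (Cmod_RIntC_le (- / B) (/ B) G); [lra|apply is_RIntC_continuous, G_continuous|].
    intros; apply HG. }
  (* Whichever of [A] and [-B] is smaller, both lie to the left of [-N]. *)
  assert (Tail : Cmod (RIntC G A (- B)) <= M / N).
  { destruct (Rle_lt_dec A (- B)) as [H|H].
    - eapply Rle_trans; [apply (tail_le M); [apply HG|exact M0|exact H|lra]|].
      rewrite Ropp_involutive. apply Rmult_le_compat_l; lra.
    - rewrite RIntC_swap, Cmod_opp.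
      eapply Rle_trans; [apply (tail_le M); [apply HG|exact M0|lra|lra]|].
      apply Rmult_le_compat_l; [lra|]. apply Rinv_le_contravar; lra. }
  rewrite (RIntC_Chasles A (- B) B), (RIntC_Chasles (- B) (- / B) B), (RIntC_Chasles (- / B) (/ B) B).
  set (I1 := RIntC G A (- B)) in *. set (I2 := RIntC G (- / B) (/ B)) in *.
  rewrite (RIntC_swap (- B) (- / B)).
  set (I3 := RIntC G (- / B) (- B)) in *. set (I4 := RIntC G (/ B) B) in *.
  (* Both edges run outwards along their half-axes, so the rectangle controls the difference
     [I3 - I4]; integrating the negative axis from left to right supplies the sign. *)
  replace (I1 + (- I3 + (I2 + I4)))%C with (I1 + (I2 + - (I3 - I4)))%C by ring.
  assert (T1 := Cmod_triangle I1 (I2 + - (I3 - I4))).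
  assert (T2 := Cmod_triangle I2 (- (I3 - I4))). rewrite Cmod_opp in T2.
  assert (M * / B <= M * / N) by (apply Rmult_le_compat_l; lra).
  assert (PI * (M * / B) <= PI * (M * / N)) by (apply Rmult_le_compat_l; lra).
  unfold Rdiv in *. lra.
Qed.
End Sufficiency.

Lemma laplace_zero (phi : R -> R) (a b : R) (w : C) : (forall t, phi t = 0) -> laplace phi a b w = RtoC 0.
Proof.
  intros H. apply (@is_RInt_unique C_R_CompleteNormedModule).
  apply (is_RInt_ext (fun _ => zero)).
  - intros t _. rewrite H. symmetry. exact (Cmult_0_r _).
  - assert (K := @is_RInt_const C_R_NormedModule a b zero).
    rewrite (@scal_zero_r R_AbsRing C_R_NormedModule) in K. exact K.
Qed.

Lemma K_causal_of_lt_1 (alpha0 g : R) (x : R * R * R) :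
  0 < alpha0 -> 0 < g < 1 -> K_causal alpha0 g x.
Proof.
  intros Ha Hg phi a b Hs Hb Hsup.
  eapply is_RInt_gen_ext.
  { apply filter_forall. intros ab w _. symmetry. apply K_integrand_eq. }
  destruct (Rle_lt_dec a b) as [Hab|Hab].
  - destruct (spectrum_integral_bound alpha0 g x phi a b Ha Hg Hs Hsup Hab (Rlt_le _ _ Hb)) as [M HM].
    apply (is_RInt_gen_of_bound _ _ M); [|exact HM].
    intros t. apply spectrum_continuous; [lra|apply smooth_continuous, Hs|exact Hab].
  (* With [b < a] every [t] satisfies [t < a] or [b < t], so the test function is identically
     zero. *)
  - assert (H0 : forall t, phi t = 0) by (intros t; apply Hsup; lra).
    assert (HS : forall w, spectrum alpha0 g x phi a b w = RtoC 0)
      by (intros w; unfold spectrum; rewrite laplace_zero by exact H0; apply Cmult_0_r).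
    assert (Hc : forall t, @continuous R_UniformSpace C_UniformSpace (spectrum alpha0 g x phi a b) t).
    { intros t. apply (continuous_ext (fun _ => RtoC 0)); [intros; symmetry; apply HS|apply continuous_const]. }
    apply (is_RInt_gen_of_bound _ _ 0); [exact Hc|].
    intros A B N HN HA HB.
    assert (K := Cmod_RIntC_le A B _ _ 0 ltac:(lra) (is_RIntC_continuous _ A B Hc)).
    unfold Rdiv; rewrite Rmult_0_l. rewrite Rmult_0_r in K. apply K.
    intros t _. rewrite HS, Cmod_0. lra.
Qed.

(** * The Fejer kernel and its Taylor polynomials *)

(** [g + f] and [g - f] both vanish at 0 and have nonnegative derivative to its right. This
    integrates a bound once without writing an integral. *)
Lemma Rabs_le_of_derive (f g f' g' : R -> R) :
  (forall t, is_derive f t (f' t)) -> (forall t, is_derive g t (g' t)) ->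
  f 0 = 0 -> g 0 = 0 -> (forall t, 0 <= t -> Rabs (f' t) <= g' t) ->
  forall y, 0 <= y -> Rabs (f y) <= g y.
Proof.
  intros Hf Hg f0 g0 H y Hy.
  assert (K : forall s, (s = 1 \/ s = -1) -> 0 <= g y + s * f y).
  { intros s Hs.
    assert (Hd : forall t, is_derive (fun t => g t + s * f t) t (g' t + s * f' t)).
    { intros t. apply (is_derive_plus g (fun t => s * f t)); [apply Hg|].
      apply (is_derive_scal f), Hf. }
    destruct (MVT_gen (fun t => g t + s * f t) 0 y (fun t => g' t + s * f' t)) as [c [Hc E]].
    - intros t _. apply Hd.
    - intros t _. apply continuity_pt_filterlim.
      apply (@ex_derive_continuous R_AbsRing R_NormedModule (fun t => g t + s * f t) t).
      exists (g' t + s * f' t). apply Hd.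
    - rewrite Rmin_left, Rmax_right in Hc by lra.
      specialize (H c (proj1 Hc)). apply Rabs_le_between in H.
      rewrite f0, g0 in E. assert (0 <= g' c + s * f' c) by (destruct Hs; subst s; lra). nra. }
  apply Rabs_le. assert (A := K 1 (or_introl eq_refl)). assert (B := K (-1) (or_intror eq_refl)). lra.
Qed.

Definition cos_poly (n : nat) (y : R) : R :=
  sum_f_R0 (fun k => (-1) ^ k * (y ^ (2 * k) / INR (fact (2 * k)))) n.
Definition sin_poly (n : nat) (y : R) : R :=
  sum_f_R0 (fun k => (-1) ^ k * (y ^ (S (2 * k)) / INR (fact (S (2 * k))))) n.

Lemma is_derive_monomial (m : nat) (y : R) :
  is_derive (fun y => y ^ S m / INR (fact (S m))) y (y ^ m / INR (fact m)).
Proof.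
  assert (A := INR_fact_neq_0 m). assert (B := not_0_INR (S m) ltac:(lia)).
  assert (H : forall c, is_derive (fun y => y ^ S m * c) y (INR (S m) * y ^ m * c)).
  { intros c. apply is_derive_Reals.
    replace (INR (S m) * y ^ m * c) with (INR (S m) * y ^ pred (S m) * c + y ^ S m * 0) by (simpl pred; ring).
    apply (derivable_pt_lim_mult (fun y => y ^ S m) (fct_cte c));
      [apply derivable_pt_lim_pow|apply derivable_pt_lim_const]. }
  replace (y ^ m / INR (fact m)) with (INR (S m) * y ^ m * / INR (fact (S m))); [apply H|].
  rewrite fact_simpl, mult_INR. field. split; assumption.
Qed.

Lemma is_derive_sum_n (f f' : nat -> R -> R) (n : nat) (y : R) :
  (forall k, is_derive (f k) y (f' k y)) ->
  is_derive (fun y => sum_f_R0 (fun k => f k y) n) y (sum_f_R0 (fun k => f' k y) n).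
Proof.
  intros H. induction n as [|n IH]; simpl; [apply H|].
  apply (is_derive_plus (fun y => sum_f_R0 (fun k => f k y) n) (f (S n))); [exact IH|apply H].
Qed.

Lemma is_derive_sin_poly (n : nat) (y : R) : is_derive (sin_poly n) y (cos_poly n y).
Proof.
  apply (is_derive_sum_n (fun k y => (-1) ^ k * (y ^ (S (2 * k)) / INR (fact (S (2 * k)))))
    (fun k y => (-1) ^ k * (y ^ (2 * k) / INR (fact (2 * k))))).
  intros k. apply (is_derive_scal (fun y => y ^ (S (2 * k)) / INR (fact (S (2 * k))))), is_derive_monomial.
Qed.

Lemma cos_poly_S (n : nat) (y : R) :
  cos_poly (S n) y = 1 + sum_f_R0 (fun k => (-1) * ((-1) ^ k * (y ^ (S (S (2 * k))) / INR (fact (S (S (2 * k))))))) n.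
Proof.
  unfold cos_poly. rewrite decomp_sum by lia. f_equal; [simpl; field|].
  apply sum_eq. intros k _. replace (2 * S k)%nat with (S (S (2 * k))) by lia. simpl pow. ring.
Qed.

Lemma is_derive_cos_poly (n : nat) (y : R) : is_derive (cos_poly (S n)) y (- sin_poly n y).
Proof.
  apply (is_derive_ext (fun y => 1 + sum_f_R0 (fun k => (-1) * ((-1) ^ k * (y ^ (S (S (2 * k))) / INR (fact (S (S (2 * k))))))) n));
    [intros; symmetry; apply cos_poly_S|].
  replace (- sin_poly n y) with
    (plus 0 (sum_f_R0 (fun k => (-1) * ((-1) ^ k * (y ^ (S (2 * k)) / INR (fact (S (2 * k)))))) n)).
  - apply (is_derive_plus (fun _ => 1)); [apply (@is_derive_const R_AbsRing R_NormedModule)|].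
    apply (is_derive_sum_n (fun k y => (-1) * ((-1) ^ k * (y ^ (S (S (2 * k))) / INR (fact (S (S (2 * k)))))))
      (fun k y => (-1) * ((-1) ^ k * (y ^ (S (2 * k)) / INR (fact (S (2 * k))))))).
    intros k.
    apply (is_derive_scal (fun y => (-1) ^ k * (y ^ (S (S (2 * k))) / INR (fact (S (S (2 * k))))))).
    apply (is_derive_scal (fun y => y ^ (S (S (2 * k))) / INR (fact (S (S (2 * k)))))), is_derive_monomial.
  - change (0 + sum_f_R0 (fun k => (-1) * ((-1) ^ k * (y ^ (S (2 * k)) / INR (fact (S (2 * k)))))) n = - sin_poly n y).
    assert (E : sum_f_R0 (fun k => (-1) * ((-1) ^ k * (y ^ (S (2 * k)) / INR (fact (S (2 * k)))))) n = -1 * sin_poly n y).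
    { unfold sin_poly. rewrite scal_sum. apply sum_eq. intros; ring. }
    rewrite E. ring.
Qed.

(** Each remainder is, up to sign, the derivative of the next one, in the order cosine, sine, cosine
    of higher degree. Starting from [|cos| <= 1], every integration from 0 raises the monomial by
    one degree. *)
Lemma cos_sin_taylor (n : nat) :
  (forall y, 0 <= y -> Rabs (cos y - cos_poly n y) <= y ^ (2 * n + 2) / INR (fact (2 * n + 2))) /\
  (forall y, 0 <= y -> Rabs (sin y - sin_poly n y) <= y ^ (2 * n + 3) / INR (fact (2 * n + 3))).
Proof.
  assert (Dc : forall t, is_derive cos t (- sin t))
    by (intros; apply is_derive_Reals, derivable_pt_lim_cos).
  assert (Ds : forall t, is_derive sin t (cos t))
    by (intros; apply is_derive_Reals, derivable_pt_lim_sin).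
  assert (Z : forall m, 0 ^ S m / INR (fact (S m)) = 0)
    by (intros; rewrite pow_i by lia; unfold Rdiv; ring).
  assert (S0 : forall n, sin_poly n 0 = 0).
  { intros m. unfold sin_poly. apply sum_eq_R0. intros k _. rewrite Z. ring. }
  assert (C0 : forall n, cos_poly n 0 = 1).
  { intros [|m]; [unfold cos_poly; simpl; field|]. rewrite cos_poly_S.
    rewrite sum_eq_R0; [ring|]. intros k _. rewrite Z. ring. }
  assert (AB : forall n,
    (forall y, 0 <= y -> Rabs (cos y - cos_poly n y) <= y ^ (2 * n + 2) / INR (fact (2 * n + 2))) ->
    (forall y, 0 <= y -> Rabs (sin y - sin_poly n y) <= y ^ (2 * n + 3) / INR (fact (2 * n + 3)))).
  { intros m H. replace (2 * m + 3)%nat with (S (2 * m + 2)) by lia.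
    apply (Rabs_le_of_derive (fun y => sin y - sin_poly m y) (fun y => y ^ S (2 * m + 2) / INR (fact (S (2 * m + 2))))
      (fun y => cos y - cos_poly m y) (fun y => y ^ (2 * m + 2) / INR (fact (2 * m + 2)))).
    - intros t. apply (is_derive_minus sin (sin_poly m)); [apply Ds|apply is_derive_sin_poly].
    - intros t; apply is_derive_monomial.
    - rewrite sin_0, S0; ring.
    - apply Z.
    - exact H. }
  assert (A0 : forall y, 0 <= y -> Rabs (cos y - cos_poly 0 y) <= y ^ (2 * 0 + 2) / INR (fact (2 * 0 + 2))).
  { apply (Rabs_le_of_derive (fun y => cos y - cos_poly 0 y) (fun y => y ^ 2 / INR (fact 2))
      (fun y => - sin y) (fun y => y ^ 1 / INR (fact 1))).
    - intros t. apply (is_derive_ext (fun y => cos y - 1)).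
      + intros s. unfold cos_poly; simpl; field.
      + replace (- sin t) with (minus (- sin t) 0) by (unfold minus, plus, opp; simpl; ring).
        apply (is_derive_minus cos (fun _ => 1)); [apply Dc|apply (@is_derive_const R_AbsRing R_NormedModule)].
    - intros t. apply is_derive_monomial.
    - rewrite cos_0, C0; ring.
    - apply Z.
    - intros t Ht. rewrite Rabs_Ropp. revert t Ht.
      apply (Rabs_le_of_derive sin (fun y => y ^ 1 / INR (fact 1)) cos (fun y => y ^ 0 / INR (fact 0))).
      + exact Ds.
      + intros t; apply is_derive_monomial.
      + apply sin_0.
      + apply Z.
      + intros t _. simpl. replace (1 / 1) with 1 by field. apply Rabs_le, COS_bound. }
  induction n as [|n [IH1 IH2]]; [exact (conj A0 (AB 0%nat A0))|].
  assert (A1 : forall y, 0 <= y -> Rabs (cos y - cos_poly (S n) y) <= y ^ (2 * S n + 2) / INR (fact (2 * S n + 2))).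
  { replace (2 * S n + 2)%nat with (S (2 * n + 3)) by lia.
    apply (Rabs_le_of_derive (fun y => cos y - cos_poly (S n) y) (fun y => y ^ S (2 * n + 3) / INR (fact (S (2 * n + 3))))
      (fun y => - (sin y - sin_poly n y)) (fun y => y ^ (2 * n + 3) / INR (fact (2 * n + 3)))).
    - intros t. replace (- (sin t - sin_poly n t)) with (minus (- sin t) (- sin_poly n t))
        by (unfold minus, plus, opp; simpl; ring).
      apply (is_derive_minus cos (cos_poly (S n))); [apply Dc|apply is_derive_cos_poly].
    - intros t; apply is_derive_monomial.
    - rewrite cos_0, C0; ring.
    - apply Z.
    - intros t Ht. rewrite Rabs_Ropp. apply IH2, Ht. }
  exact (conj A1 (AB (S n) A1)).
Qed.

Lemma cos_poly_opp (n : nat) (y : R) : cos_poly n (- y) = cos_poly n y.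
Proof.
  apply sum_eq. intros k _. rewrite !pow_mult. replace ((- y) ^ 2) with (y ^ 2) by ring. reflexivity.
Qed.

Lemma cos_taylor (n : nat) (y : R) :
  Rabs (cos y - cos_poly n y) <= Rabs y ^ (2 * n + 2) / INR (fact (2 * n + 2)).
Proof.
  destruct (Rle_dec 0 y) as [H|H].
  - rewrite (Rabs_pos_eq y) by exact H. apply cos_sin_taylor, H.
  - rewrite (Rabs_left y) by lra. rewrite <- (cos_neg y), <- (cos_poly_opp n y).
    apply cos_sin_taylor. lra.
Qed.

Lemma pow_div_fact_le_exp (m : nat) (y : R) : 0 <= y -> y ^ m / INR (fact m) <= exp y.
Proof.
  intros Hy. eapply Rle_trans; [|apply (exp_ge_taylor y m Hy)].
  assert (P : forall k, 0 <= y ^ k / INR (fact k)).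
  { intros k. apply Rmult_le_pos; [apply pow_le, Hy|]. left. apply Rinv_0_lt_compat, INR_fact_lt_0. }
  destruct m as [|m]; [simpl; lra|rewrite tech5].
  assert (0 <= sum_f_R0 (fun k => y ^ k / INR (fact k)) m) by (apply cond_pos_sum; exact P). lra.
Qed.

(* The Fejer kernel, up to normalization. *)
Definition fejer (N w : R) : R := if Req_EM_T w 0 then N ^ 2 / 2 else (1 - cos (N * w)) / w ^ 2.

(** The Taylor polynomial of [1 - cos (N w)] divided by [w^2]. Only even powers of [w] occur, so
    even moments suffice to integrate it. *)
Definition fejer_poly (N : R) (n : nat) (w : R) : R :=
  sum_f_R0 (fun k => (-1) ^ k * N ^ (2 * k + 2) / INR (fact (2 * k + 2)) * w ^ (2 * k)) n.

Lemma fejer_poly_cos_poly (N : R) (n : nat) (w : R) :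
  w ^ 2 * fejer_poly N n w = 1 - cos_poly (S n) (N * w).
Proof.
  rewrite cos_poly_S. unfold fejer_poly. rewrite scal_sum.
  replace (1 - (1 + sum_f_R0 (fun k => -1 * ((-1) ^ k * ((N * w) ^ S (S (2 * k)) / INR (fact (S (S (2 * k))))))) n))
    with (-1 * sum_f_R0 (fun k => -1 * ((-1) ^ k * ((N * w) ^ S (S (2 * k)) / INR (fact (S (S (2 * k))))))) n) by ring.
  rewrite scal_sum. apply sum_eq. intros k _.
  replace (2 * k + 2)%nat with (S (S (2 * k))) by lia. rewrite Rpow_mult_distr. simpl pow.
  field. apply INR_fact_neq_0.
Qed.

Lemma fejer_sq (N w : R) : w ^ 2 * fejer N w = 1 - cos (N * w).
Proof.
  unfold fejer. destruct Req_EM_T as [->|H].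
  - rewrite Rmult_0_r, cos_0. ring.
  - field. exact H.
Qed.

Lemma fejer_pos (N w : R) : 0 <= fejer N w.
Proof.
  unfold fejer. destruct Req_EM_T as [_|H]; [nra|].
  apply Rmult_le_pos; [assert (B := COS_bound (N * w)); lra|].
  left. apply Rinv_0_lt_compat. nra.
Qed.

(** Multiplying by [w^2] turns the error into the Taylor remainder of the cosine. At [w = 0] both
    sides of the difference equal [N^2 / 2]. *)
Lemma fejer_approx (N w : R) (n : nat) :
  Rabs (fejer N w - fejer_poly N n w) <= N ^ 2 * (Rabs (N * w) ^ (2 * n + 2) / INR (fact (2 * n + 4))).
Proof.
  assert (F := INR_fact_lt_0 (2 * n + 4)).
  destruct (Req_dec w 0) as [->|Hw].
  - assert (E : fejer_poly N n 0 = fejer N 0).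
    { unfold fejer. destruct Req_EM_T as [_|]; [|lra]. unfold fejer_poly. destruct n as [|n].
      - simpl. field.
      - rewrite decomp_sum by lia. rewrite sum_eq_R0; [simpl; field|].
        intros k _. rewrite (pow_i (2 * S k)) by lia. ring. }
    rewrite E, Rminus_diag, Rabs_R0, Rmult_0_r, Rabs_R0, (pow_i (2 * n + 2)) by lia.
    unfold Rdiv. rewrite Rmult_0_l, Rmult_0_r. lra.
  - assert (P : 0 < w ^ 2) by (assert (0 < w * w) by (apply Rsqr_pos_lt, Hw); nra).
    apply Rmult_le_reg_l with (w ^ 2); [exact P|].
    rewrite <- (Rabs_pos_eq (w ^ 2)) at 1 by lra. rewrite <- Rabs_mult.
    rewrite Rmult_minus_distr_l, fejer_poly_cos_poly, fejer_sq.
    replace (1 - cos (N * w) - (1 - cos_poly (S n) (N * w))) with (- (cos (N * w) - cos_poly (S n) (N * w))) by ring.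
    rewrite Rabs_Ropp. eapply Rle_trans; [apply cos_taylor|].
    replace (2 * S n + 2)%nat with (2 * n + 2 + 2)%nat by lia.
    replace (2 * n + 4)%nat with (2 * n + 2 + 2)%nat by lia.
    rewrite (pow_add _ (2 * n + 2) 2). right. rewrite pow2_abs. field.
    replace (2 * n + 2 + 2)%nat with (2 * n + 4)%nat by lia. lra.
Qed.

(** From [y^m / m! = 2^(-m) (2 y)^m / m! <= 2^(-m) e^(2 y)]. The error is geometrically small in [n]
    uniformly in [w], up to an exponential weight that the decay of mu can absorb. *)
Lemma fejer_approx_exp (N w : R) (n : nat) : 0 <= N ->
  Rabs (fejer N w - fejer_poly N n w) <= N ^ 2 * (/ 2) ^ (2 * n + 2) * exp (2 * N * Rabs w).
Proof.
  intros HN. eapply Rle_trans; [apply fejer_approx|]. rewrite Rmult_assoc.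
  apply Rmult_le_compat_l; [nra|]. rewrite Rabs_mult, (Rabs_pos_eq N) by exact HN.
  assert (Y0 : 0 <= N * Rabs w) by (apply Rmult_le_pos; [exact HN|apply Rabs_pos]).
  apply Rle_trans with ((N * Rabs w) ^ (2 * n + 2) / INR (fact (2 * n + 2))).
  - apply Rmult_le_compat_l; [apply pow_le, Y0|].
    apply Rinv_le_contravar; [apply INR_fact_lt_0|]. apply le_INR, fact_le. lia.
  - assert (B := pow_div_fact_le_exp (2 * n + 2) (2 * (N * Rabs w)) ltac:(lra)).
    rewrite (Rmult_assoc 2 N). apply Rmult_le_compat_l with (r := (/ 2) ^ (2 * n + 2)) in B;
      [|apply pow_le; lra].
    eapply Rle_trans; [|exact B]. right. rewrite (Rpow_mult_distr 2).
    unfold Rdiv. rewrite <- !Rmult_assoc, <- Rpow_mult_distr, Rinv_l, pow1 by lra. ring.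
Qed.

(** The approximation of order 0 puts the kernel within [N^2 / 24] of [N^2 / 2]. *)
Lemma fejer_lower (N w : R) : Rabs (N * w) <= 1 -> N ^ 2 / 4 <= fejer N w.
Proof.
  intros H. assert (A := fejer_approx N w 0). simpl in A. unfold fejer_poly in A; simpl in A.
  assert (B := Rabs_pos (N * w)).
  assert (Rabs (N * w) * (Rabs (N * w) * 1) <= 1) by nra.
  apply Rabs_le_between in A. nra.
Qed.

Lemma fejer_upper (N w : R) : w <> 0 -> fejer N w <= 2 / w ^ 2.
Proof.
  intros H. unfold fejer. destruct Req_EM_T; [contradiction|].
  apply Rmult_le_compat_r; [left; apply Rinv_0_lt_compat; assert (0 < w * w) by (apply Rsqr_pos_lt, H); nra|].
  assert (B := COS_bound (N * w)); lra.
Qed.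

Lemma fejer_continuous (N w : R) : continuous (fejer N) w.
Proof.
  destruct (Req_dec w 0) as [->|Hw].
  - intros P [e He].
    assert (N4 : 0 <= N ^ 4) by (replace (N ^ 4) with ((N ^ 2) ^ 2) by ring; apply pow2_ge_0).
    assert (He' := cond_pos e).
    assert (Hd : 0 < Rmin 1 (e / (N ^ 4 + 1))) by (apply Rmin_pos; [lra|apply Rdiv_lt_0_compat; lra]).
    exists (mkposreal _ Hd). intros w Hw. apply He.
    unfold ball in *; simpl in *; unfold AbsRing_ball, abs, minus, plus, opp in *; simpl in *.
    rewrite Ropp_0, Rplus_0_r in Hw.
    assert (W1 := Rlt_le_trans _ _ _ Hw (Rmin_l _ _)). assert (W2 := Rlt_le_trans _ _ _ Hw (Rmin_r _ _)).
    assert (A := fejer_approx N w 0). unfold fejer_poly in A; simpl in A. unfold fejer at 2.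
    destruct Req_EM_T as [_|]; [|lra].
    assert (W0 := Rabs_pos w).
    rewrite Rabs_mult in A.
    assert (E : (Rabs N * Rabs w) * ((Rabs N * Rabs w) * 1) = N ^ 2 * Rabs w ^ 2)
      by (rewrite <- (pow2_abs N); ring).
    rewrite E in A.
    assert (K : Rabs w * (N ^ 4 + 1) < e).
    { apply Rmult_lt_compat_r with (r := N ^ 4 + 1) in W2; [|lra].
      unfold Rdiv in W2. rewrite Rmult_assoc, Rinv_l in W2; lra. }
    replace (fejer N w + - (N ^ 2 / 2)) with (fejer N w - 1 * (N * (N * 1)) / (1 + 1) * 1) by field.
    eapply Rle_lt_trans; [exact A|].
    apply Rle_lt_trans with (N ^ 4 * Rabs w ^ 2); [|nra].
    replace (N * (N * 1) * (N ^ 2 * Rabs w ^ 2 / _)) with (N ^ 4 * Rabs w ^ 2 * / 24) by (simpl; field).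
    assert (0 <= N ^ 4 * Rabs w ^ 2) by (apply Rmult_le_pos; [exact N4|apply pow2_ge_0]). lra.
  - apply (continuous_ext_loc _ (fun w => (1 - cos (N * w)) / w ^ 2)).
    + exists (mkposreal _ (Rabs_pos_lt w Hw)). intros y Hy. unfold fejer.
      destruct Req_EM_T as [->|]; [|reflexivity]. exfalso.
      unfold ball in Hy; simpl in Hy; unfold AbsRing_ball, abs, minus, plus, opp in Hy; simpl in Hy.
      rewrite Rplus_0_l, Rabs_Ropp in Hy. lra.
    + apply (@ex_derive_continuous R_AbsRing R_NormedModule (fun w => (1 - cos (N * w)) / w ^ 2)).
      auto_derive. nra.
Qed.

(** * Functions with vanishing even moments *)

Lemma ex_RInt_cont (f : R -> R) (a b : R) : (forall t, continuous f t) -> ex_RInt f a b.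
Proof. intros H. apply (@ex_RInt_continuous R_CompleteNormedModule). intros z _. apply H. Qed.

Lemma continuous_Rmult (f g : R -> R) (t : R) :
  continuous f t -> continuous g t -> continuous (fun s => f s * g s) t.
Proof. apply (@continuous_mult R_UniformSpace R_AbsRing). Qed.

Lemma continuous_Rminus (f g : R -> R) (t : R) :
  continuous f t -> continuous g t -> continuous (fun s => f s - g s) t.
Proof. apply (@continuous_minus R_UniformSpace R_AbsRing R_NormedModule). Qed.

Lemma continuous_monomial (c : R) (n : nat) (t : R) : continuous (fun s => c * s ^ n) t.
Proof.
  apply (@ex_derive_continuous R_AbsRing R_NormedModule (fun s => c * s ^ n)). auto_derive. exact I.
Qed.

Lemma continuous_sum_n (f : nat -> R -> R) (n : nat) (t : R) :
  (forall k, continuous (f k) t) -> continuous (fun s => sum_f_R0 (fun k => f k s) n) t.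
Proof.
  intros H. induction n as [|n IH]; simpl; [apply H|].
  apply (@continuous_plus R_UniformSpace R_AbsRing R_NormedModule (fun s => sum_f_R0 (fun k => f k s) n) (f (S n)));
    [exact IH|apply H].
Qed.

Lemma fejer_poly_continuous (N : R) (n : nat) (t : R) : continuous (fejer_poly N n) t.
Proof.
  apply (continuous_sum_n (fun k w => (-1) ^ k * N ^ (2 * k + 2) / INR (fact (2 * k + 2)) * w ^ (2 * k))).
  intros k. apply continuous_monomial.
Qed.

Lemma cauchy_density_continuous (t : R) : continuous (fun w => / (1 + w ^ 2)) t.
Proof.
  apply (@ex_derive_continuous R_AbsRing R_NormedModule (fun w => / (1 + w ^ 2))). auto_derive. nra.
Qed.

Lemma cauchy_density_integral (r : R) : 0 <= r -> RInt (fun w => / (1 + w ^ 2)) (- r) r <= PI.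
Proof.
  intros Hr.
  assert (H : is_RInt (fun w => / (1 + w ^ 2)) (- r) r (minus (atan r) (atan (- r)))).
  { apply (@is_RInt_derive R_CompleteNormedModule atan).
    - intros x _. apply is_derive_Reals, derivable_pt_lim_atan.
    - intros x _. apply cauchy_density_continuous. }
  apply (@is_RInt_unique R_CompleteNormedModule) in H. rewrite H. unfold minus, plus, opp; simpl.
  rewrite atan_opp. assert (B := atan_bound r). lra.
Qed.

(** The interval [[-1/N, 1/N]] alone contributes its length [2/N] times the lower bound [N^2 / 4];
    the rest is nonnegative. *)
Lemma fejer_integral (N r : R) : 0 < N -> / N <= r -> N / 2 <= RInt (fejer N) (- r) r.
Proof.
  intros HN Hr.
  assert (HI : 0 < / N) by (apply Rinv_0_lt_compat, HN).
  assert (EX : forall u v, ex_RInt (fejer N) u v) by (intros; apply ex_RInt_cont, fejer_continuous).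
  rewrite <- (RInt_Chasles (fejer N) (- r) (- / N) r) by apply EX.
  rewrite <- (RInt_Chasles (fejer N) (- / N) (/ N) r) by apply EX.
  assert (A : 0 <= RInt (fejer N) (- r) (- / N)) by (apply RInt_ge_0; [lra|apply EX|intros; apply fejer_pos]).
  assert (B : 0 <= RInt (fejer N) (/ N) r) by (apply RInt_ge_0; [lra|apply EX|intros; apply fejer_pos]).
  assert (D : RInt (fun _ => N ^ 2 / 4) (- / N) (/ N) <= RInt (fejer N) (- / N) (/ N)).
  { apply RInt_le; [lra|apply ex_RInt_const|apply EX|]. intros w Hw. apply fejer_lower.
    rewrite Rabs_mult, Rabs_pos_eq by lra. rewrite <- (Rinv_r N) by lra.
    apply Rmult_le_compat_l; [lra|]. apply Rabs_le; lra. }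
  rewrite RInt_const in D. unfold scal in D; simpl in D; unfold mult in D; simpl in D.
  replace ((/ N - - / N) * (N * (N * 1) / 4)) with (N / 2) in D by (field; lra).
  unfold plus; simpl. lra.
Qed.

Lemma is_lim_fejer_poly (mu : R -> R) (N : R) (n : nat) :
  (forall t, continuous mu t) ->
  (forall k, is_lim (fun r => RInt (fun w => mu w * w ^ (2 * k)) (- r) r) p_infty 0) ->
  is_lim (fun r => RInt (fun w => mu w * fejer_poly N n w) (- r) r) p_infty 0.
Proof.
  intros Hc Hm.
  assert (T : forall c k, is_lim (fun r => RInt (fun w => mu w * (c * w ^ (2 * k))) (- r) r) p_infty 0).
  { intros c k. apply (is_lim_ext (fun r => c * RInt (fun w => mu w * w ^ (2 * k)) (- r) r)).
    - intros r. transitivity (RInt (fun w => c * (mu w * w ^ (2 * k))) (- r) r).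
      + symmetry. apply (RInt_scal (fun w => mu w * w ^ (2 * k)) (- r) r c).
        apply ex_RInt_cont. intros t. apply continuous_Rmult; [apply Hc|].
        apply (continuous_ext (fun s => 1 * s ^ (2 * k))); [intros; apply Rmult_1_l|apply continuous_monomial].
      + apply RInt_ext. intros w _. change (c * (mu w * w ^ (2 * k)) = mu w * (c * w ^ (2 * k))). ring.
    - replace (Finite 0) with (Rbar_mult c 0) by (simpl; f_equal; ring).
      apply is_lim_scal_l, Hm. }
  unfold fejer_poly. induction n as [|n IH].
  - apply (is_lim_ext (fun r => RInt (fun w => mu w * ((-1) ^ 0 * N ^ (2 * 0 + 2) / INR (fact (2 * 0 + 2)) * w ^ (2 * 0))) (- r) r)).
    + intros r; reflexivity.
    + apply T.
  - apply (is_lim_ext (fun r =>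
      RInt (fun w => mu w * sum_f_R0 (fun k => (-1) ^ k * N ^ (2 * k + 2) / INR (fact (2 * k + 2)) * w ^ (2 * k)) n) (- r) r
      + RInt (fun w => mu w * ((-1) ^ (S n) * N ^ (2 * S n + 2) / INR (fact (2 * S n + 2)) * w ^ (2 * S n))) (- r) r)).
    + intros r. set (p := fejer_poly N n).
      set (q := fun w => (-1) ^ (S n) * N ^ (2 * S n + 2) / INR (fact (2 * S n + 2)) * w ^ (2 * S n)).
      transitivity (RInt (fun w => mu w * p w + mu w * q w) (- r) r);
        [symmetry; apply (@RInt_plus R_CompleteNormedModule (fun w => mu w * p w) (fun w => mu w * q w))|].
      * apply ex_RInt_cont. intros t. apply continuous_Rmult; [apply Hc|apply fejer_poly_continuous].
      * apply ex_RInt_cont. intros t. apply continuous_Rmult; [apply Hc|apply continuous_monomial].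
      * apply RInt_ext. intros w _. rewrite tech5. symmetry. apply Rmult_plus_distr_l.
    + replace (Finite 0) with (Finite (0 + 0)) by (f_equal; ring).
      apply is_lim_plus'; [exact IH|apply T].
Qed.

Lemma half_pow_small (c : R) : 0 <= c -> exists n, c * (/ 2) ^ (2 * n + 2) <= 1.
Proof.
  intros Hc.
  destruct (pow_lt_1_zero (/ 2) ltac:(rewrite Rabs_pos_eq; lra) (/ (c + 1)) ltac:(apply Rinv_0_lt_compat; lra))
    as [n Hn].
  exists n. specialize (Hn (2 * n + 2)%nat ltac:(lia)).
  rewrite Rabs_pos_eq in Hn by (apply pow_le; lra).
  apply Rle_trans with (c * / (c + 1)); [apply Rmult_le_compat_l; lra|].
  apply Rmult_le_reg_r with (c + 1); [lra|]. rewrite Rmult_assoc, Rinv_l; lra.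
Qed.

(** Assuming [0 < mu 0], a pointwise lower bound for [mu * fejer_poly] is integrated over [[-r, r]].
    This avoids exchanging a limit with an integral. The constants are chosen in the order [K], [N],
    [D], [n], [r], each depending only on earlier ones; the lower bound is then at least 1 while the
    integral tends to 0. *)
Lemma vanishing_even_moments (mu : R -> R) :
  (forall t, continuous mu t) ->
  (forall N, exists D, forall w, Rabs (mu w) * exp (N * Rabs w) * (1 + w ^ 2) <= D) ->
  (forall k, is_lim (fun r => RInt (fun w => mu w * w ^ (2 * k)) (- r) r) p_infty 0) ->
  mu 0 <= 0.
Proof.
  intros Hc Hd Hm. apply Rnot_lt_le. intros H0.
  destruct (Hc 0 (fun z => Rabs (z - mu 0) < mu 0 / 2)) as [d Hdelta].
  { assert (P : 0 < mu 0 / 2) by lra. exists (mkposreal _ P). intros z Hz; exact Hz. }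
  assert (Hdp := cond_pos d). set (dl := pos d) in *.
  assert (Near : forall w, Rabs w < dl -> mu 0 / 2 <= mu w).
  { intros w Hw. assert (A : Rabs (mu w - mu 0) < mu 0 / 2).
    { apply Hdelta. unfold ball; simpl; unfold AbsRing_ball, abs, minus, plus, opp; simpl.
      rewrite Ropp_0, Rplus_0_r. exact Hw. }
    apply Rabs_def2 in A. lra. }
  destruct (Hd 0) as [C0 HC0].
  assert (Mu : forall w, Rabs (mu w) <= C0).
  { intros w. specialize (HC0 w). rewrite Rmult_0_l, exp_0 in HC0.
    assert (A := Rabs_pos (mu w)). assert (B := pow2_ge_0 w). nra. }
  assert (C0p : 0 <= C0) by (eapply Rle_trans; [apply Rabs_pos|apply (Mu 0)]).
  (* Cost of the region [|w| >= dl], where [mu] may be negative: there the kernel is at most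
     [2 / w^2], itself at most [2 (1 + 1/dl^2) / (1 + w^2)]. It is essential that [K] is independent
     of [N]. *)
  set (K := (C0 + mu 0 / 2) * (2 * (1 + / dl ^ 2))).
  assert (Pd2 : 0 < dl ^ 2) by (apply pow_lt, Hdp).
  assert (K0 : 0 <= K).
  { apply Rmult_le_pos; [lra|]. assert (0 < / dl ^ 2) by (apply Rinv_0_lt_compat, Pd2). lra. }
  (* Solves [mu 0 / 2 * (N / 2) = (K + 1) * PI + 1]: the mass near 0 exceeds the total loss by 1. *)
  set (N := 4 / mu 0 * ((K + 1) * PI + 1)).
  assert (Hpi := PI_RGT_0).
  assert (HN : 0 < N).
  { apply Rmult_lt_0_compat; [apply Rdiv_lt_0_compat; lra|].
    assert (0 <= (K + 1) * PI) by (apply Rmult_le_pos; lra). lra. }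
  destruct (Hd (2 * N)) as [D HD].
  assert (Dp : 0 <= D).
  { eapply Rle_trans; [|apply (HD 0)]. apply Rmult_le_pos; [apply Rmult_le_pos|].
    - apply Rabs_pos.
    - left; apply exp_pos.
    - nra. }
  (* The degree is fixed after [D], so that replacing the kernel by its polynomial costs at most
     [1 / (1 + w^2)], the extra 1 in [K + 1]. *)
  destruct (half_pow_small (D * N ^ 2)) as [n Hn]; [apply Rmult_le_pos; [exact Dp|apply pow2_ge_0]|].
  assert (Low : forall w, mu 0 / 2 * fejer N w - (K + 1) * / (1 + w ^ 2) <= mu w * fejer_poly N n w).
  { intros w. assert (W := pow2_ge_0 w). assert (F := fejer_pos N w).
    assert (I0 : 0 < / (1 + w ^ 2)) by (apply Rinv_0_lt_compat; lra).
    assert (A1 : mu 0 / 2 * fejer N w - K * / (1 + w ^ 2) <= mu w * fejer N w).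
    { destruct (Rlt_le_dec (Rabs w) dl) as [Hw|Hw].
      - specialize (Near w Hw).
        assert (mu 0 / 2 * fejer N w <= mu w * fejer N w) by (apply Rmult_le_compat_r; lra).
        assert (0 <= K * / (1 + w ^ 2)) by (apply Rmult_le_pos; lra). lra.
      - assert (w2 : dl ^ 2 <= w ^ 2) by (rewrite <- (pow2_abs w); apply pow_incr; lra).
        assert (Hw0 : w <> 0) by (intros ->; rewrite Rabs_R0 in Hw; lra).
        assert (U := fejer_upper N w Hw0).
        assert (V : 2 / w ^ 2 <= 2 * (1 + / dl ^ 2) * / (1 + w ^ 2)).
        { apply Rmult_le_reg_r with (w ^ 2 * (1 + w ^ 2)); [apply Rmult_lt_0_compat; lra|].
          replace (2 / w ^ 2 * (w ^ 2 * (1 + w ^ 2))) with (2 * (1 + w ^ 2)) by (field; lra).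
          replace (2 * (1 + / dl ^ 2) * / (1 + w ^ 2) * (w ^ 2 * (1 + w ^ 2)))
            with (2 * (w ^ 2 + w ^ 2 / dl ^ 2)) by (field; lra).
          assert (1 <= w ^ 2 / dl ^ 2); [|lra].
          apply Rmult_le_reg_r with (dl ^ 2); [exact Pd2|]. unfold Rdiv. rewrite Rmult_assoc, Rinv_l; lra. }
        specialize (Mu w). apply Rabs_le_between in Mu.
        assert ((mu 0 / 2 - mu w) * fejer N w <= (C0 + mu 0 / 2) * fejer N w)
          by (apply Rmult_le_compat_r; lra).
        assert ((C0 + mu 0 / 2) * fejer N w <= (C0 + mu 0 / 2) * (2 * (1 + / dl ^ 2) * / (1 + w ^ 2)))
          by (apply Rmult_le_compat_l; lra).
        unfold K. lra. }
    assert (A2 : Rabs (mu w * (fejer N w - fejer_poly N n w)) <= / (1 + w ^ 2)).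
    { rewrite Rabs_mult. apply Rmult_le_reg_r with (1 + w ^ 2); [lra|]. rewrite Rinv_l by lra.
      apply Rle_trans with (Rabs (mu w) * (N ^ 2 * (/ 2) ^ (2 * n + 2) * exp (2 * N * Rabs w)) * (1 + w ^ 2)).
      - apply Rmult_le_compat_r; [lra|]. apply Rmult_le_compat_l; [apply Rabs_pos|].
        apply fejer_approx_exp; lra.
      - replace (Rabs (mu w) * (N ^ 2 * (/ 2) ^ (2 * n + 2) * exp (2 * N * Rabs w)) * (1 + w ^ 2))
          with (Rabs (mu w) * exp (2 * N * Rabs w) * (1 + w ^ 2) * (N ^ 2 * (/ 2) ^ (2 * n + 2))) by ring.
        apply Rle_trans with (D * (N ^ 2 * (/ 2) ^ (2 * n + 2))); [|lra].
        apply Rmult_le_compat_r; [|apply HD].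
        apply Rmult_le_pos; [apply pow2_ge_0|apply pow_le; lra]. }
    apply Rabs_le_between in A2. lra. }
  assert (L := is_lim_fejer_poly mu N n Hc Hm). apply is_lim_spec in L.
  destruct (L (mkposreal 1 Rlt_0_1)) as [T HT].
  set (r := Rmax (T + 1) (/ N)).
  assert (HIN : 0 < / N) by (apply Rinv_0_lt_compat, HN).
  assert (r1 : T < r) by (eapply Rlt_le_trans; [|apply Rmax_l]; lra).
  assert (r2 : / N <= r) by apply Rmax_r.
  specialize (HT r r1). simpl in HT. rewrite Rminus_0_r in HT. apply Rabs_def2 in HT.
  assert (B1 := fejer_integral N r HN r2).
  assert (B2 := cauchy_density_integral r ltac:(lra)).
  assert (X1 : forall t, continuous (fun w => mu 0 / 2 * fejer N w) t)
    by (intros; apply (continuous_scal_r _ (fejer N)), fejer_continuous).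
  assert (X2 : forall t, continuous (fun w => (K + 1) * / (1 + w ^ 2)) t)
    by (intros; apply (continuous_scal_r _ (fun w => / (1 + w ^ 2))), cauchy_density_continuous).
  assert (B3 : RInt (fun w => mu 0 / 2 * fejer N w - (K + 1) * / (1 + w ^ 2)) (- r) r
    <= RInt (fun w => mu w * fejer_poly N n w) (- r) r).
  { apply RInt_le; [lra| | |intros; apply Low]; apply ex_RInt_cont; intros t.
    - apply continuous_Rminus; auto.
    - apply continuous_Rmult; [apply Hc|apply fejer_poly_continuous]. }
  rewrite (RInt_minus (fun w => mu 0 / 2 * fejer N w) (fun w => (K + 1) * / (1 + w ^ 2))) in B3
    by (apply ex_RInt_cont; auto).
  rewrite (RInt_scal (fejer N)), (RInt_scal (fun w => / (1 + w ^ 2))) in B3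
    by (apply ex_RInt_cont; intros; [apply fejer_continuous || apply cauchy_density_continuous]).
  unfold minus, plus, opp, scal, mult in B3; simpl in B3. unfold mult in B3; simpl in B3.
  set (IE := RInt (fejer N) (- r) r) in *.
  assert (Q1 : mu 0 / 2 * (N / 2) <= mu 0 / 2 * IE) by (apply Rmult_le_compat_l; lra).
  replace (mu 0 / 2 * (N / 2)) with ((K + 1) * PI + 1) in Q1 by (unfold N; field; lra).
  assert (Q2 : (K + 1) * RInt (fun w => / (1 + w * (w * 1))) (- r) r <= (K + 1) * PI)
    by (apply Rmult_le_compat_l; [lra|exact B2]).
  lra.
Qed.

(** * A smooth bump function *)

(** Differentiability of order [k] with explicit derivatives as witnesses. Unlike [Derive_n], this
    form lets closure under sums, products and affine changes follow by induction on [k]. *)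
Fixpoint Ck (k : nat) (f : R -> R) : Prop :=
  match k with
  | O => True
  | S k => exists f', (forall t, is_derive f t (f' t)) /\ Ck k f'
  end.

Lemma Ck_smooth (f : R -> R) : (forall k, Ck k f) -> smooth f.
Proof.
  intros H n t. specialize (H n). revert f H t. induction n as [|n IH]; intros f H t; [exact I|].
  destruct H as [f' [Hd H]]. specialize (IH f' H). simpl. destruct n as [|n].
  - exists (f' t). apply Hd.
  - apply (ex_derive_ext (Derive_n f' n)); [|exact (IH t)].
    intros s. transitivity (Derive_n (Derive f) n s).
    + apply Derive_n_ext. intros u. symmetry. apply is_derive_unique, Hd.
    + apply Derive_n_Derive.
Qed.

Lemma Ck_pred (k : nat) (f : R -> R) : Ck (S k) f -> Ck k f.
Proof.
  revert f. induction k as [|k IH]; intros f H; [exact I|].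
  destruct H as [f' [Hd H]]. exists f'. split; [exact Hd|apply IH, H].
Qed.

Lemma Ck_plus (k : nat) (f g : R -> R) : Ck k f -> Ck k g -> Ck k (fun t => f t + g t).
Proof.
  revert f g. induction k as [|k IH]; intros f g Hf Hg; [exact I|].
  destruct Hf as [f' [Df Hf]], Hg as [g' [Dg Hg]]. exists (fun t => f' t + g' t). split.
  - intros t. apply (is_derive_plus f g); [apply Df|apply Dg].
  - apply IH; assumption.
Qed.

Lemma Ck_scal (k : nat) (c : R) (f : R -> R) : Ck k f -> Ck k (fun t => c * f t).
Proof.
  revert f. induction k as [|k IH]; intros f Hf; [exact I|].
  destruct Hf as [f' [Df Hf]]. exists (fun t => c * f' t). split.
  - intros t. apply (is_derive_scal f), Df.
  - apply IH, Hf.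
Qed.

Lemma Ck_mult (k : nat) (f g : R -> R) : Ck k f -> Ck k g -> Ck k (fun t => f t * g t).
Proof.
  revert f g. induction k as [|k IH]; intros f g Hf Hg; [exact I|].
  assert (Hf0 := Ck_pred _ _ Hf). assert (Hg0 := Ck_pred _ _ Hg).
  destruct Hf as [f' [Df Hf]], Hg as [g' [Dg Hg]]. exists (fun t => f' t * g t + f t * g' t). split.
  - intros t. apply is_derive_Rmult; [apply Df|apply Dg].
  - apply Ck_plus; apply IH; assumption.
Qed.

Lemma Ck_affine (k : nat) (c d : R) (f : R -> R) : Ck k f -> Ck k (fun t => f (c * t + d)).
Proof.
  revert f. induction k as [|k IH]; intros f Hf; [exact I|].
  destruct Hf as [f' [Df Hf]]. exists (fun t => c * f' (c * t + d)). split.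
  - intros t. apply (is_derive_comp f (fun t => c * t + d)); [apply Df|].
    auto_derive; [exact I|ring].
  - apply Ck_scal, IH, Hf.
Qed.

(* These functions span a space stable under differentiation, which makes each of them smooth. *)
Definition flat (n : nat) (x : R) : R :=
  if Rlt_dec 0 x then (/ x) ^ n * exp (- / x) else 0.

(** One Taylor term of the exponential at [y = 1/x], namely [y^(n+2) / (n+2)! <= e^y]. The two extra
    powers leave the [x^2] that makes the derivative at 0 vanish. *)
Lemma flat_le (n : nat) (x : R) : Rabs (flat n x) <= INR (fact (n + 2)) * x ^ 2.
Proof.
  assert (F := INR_fact_lt_0 (n + 2)). unfold flat. destruct Rlt_dec as [H|H].
  - assert (Y : 0 < / x) by (apply Rinv_0_lt_compat, H).
    assert (P := pow_div_fact_le_exp (n + 2) (/ x) (Rlt_le _ _ Y)).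
    assert (EP := exp_pos (- / x)).
    rewrite Rabs_pos_eq by (apply Rmult_le_pos; [apply pow_le|]; lra).
    replace ((/ x) ^ n * exp (- / x)) with
      (x ^ 2 * exp (- / x) * INR (fact (n + 2)) * ((/ x) ^ (n + 2) / INR (fact (n + 2)))).
    + apply Rle_trans with (x ^ 2 * exp (- / x) * INR (fact (n + 2)) * exp (/ x)).
      * apply Rmult_le_compat_l; [|exact P]. repeat apply Rmult_le_pos; try lra.
      * right. replace (x ^ 2 * exp (- / x) * INR (fact (n + 2)) * exp (/ x)) with
          (x ^ 2 * INR (fact (n + 2)) * (exp (- / x) * exp (/ x))) by ring.
        rewrite <- exp_plus, Rplus_opp_l, exp_0. ring.
    + rewrite pow_add, !pow_inv. field. repeat split; try lra. apply pow_nonzero; lra.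
  - rewrite Rabs_R0. apply Rmult_le_pos; [lra|apply pow2_ge_0].
Qed.

Lemma is_derive_flat (n : nat) (x : R) :
  is_derive (flat n) x (flat (n + 2) x + - INR n * flat (n + 1) x).
Proof.
  destruct (Rtotal_order x 0) as [H|[->|H]].
  - apply (is_derive_ext_loc (fun _ => 0)).
    + assert (Hx : 0 < - x) by lra. exists (mkposreal _ Hx). intros y Hy. apply Rabs_def2 in Hy.
      unfold minus, plus, opp in Hy; simpl in Hy. unfold flat. destruct Rlt_dec; lra.
    + replace (flat (n + 2) x + - INR n * flat (n + 1) x) with 0
        by (unfold flat; destruct Rlt_dec; [lra|ring]).
      apply (@is_derive_const R_AbsRing R_NormedModule).
  - assert (E : forall m, flat m 0 = 0) by (intros; unfold flat; destruct Rlt_dec; lra).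
    rewrite !E. apply is_derive_eps_R. intros eps Heps.
    assert (F := INR_fact_lt_0 (n + 2)).
    exists (eps / INR (fact (n + 2))). split; [apply Rdiv_lt_0_compat; lra|].
    intros h Hh. rewrite E, Rplus_0_l.
    replace (flat n h - 0 - (0 + - INR n * 0) * h) with (flat n h) by ring.
    eapply Rle_trans; [apply flat_le|]. rewrite <- (pow2_abs h).
    assert (A := Rabs_pos h). apply Rmult_lt_compat_l with (r := INR (fact (n + 2))) in Hh; [|exact F].
    replace (INR (fact (n + 2)) * (eps / INR (fact (n + 2)))) with eps in Hh by (field; lra).
    replace (INR (fact (n + 2)) * Rabs h ^ 2) with (INR (fact (n + 2)) * Rabs h * Rabs h) by ring.
    apply Rmult_le_compat_r; lra.
  - apply (is_derive_ext_loc (fun x => (/ x) ^ n * exp (- / x))).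
    + exists (mkposreal _ H). intros y Hy. apply Rabs_def2 in Hy.
      unfold minus, plus, opp in Hy; simpl in Hy. unfold flat. destruct Rlt_dec; lra.
    + assert (D1 : is_derive (fun x => / x) x (- / x ^ 2)) by (auto_derive; [lra|field; lra]).
      assert (D2 : is_derive (fun x => exp (- / x)) x (/ x ^ 2 * exp (- / x)))
        by (auto_derive; [lra|field; lra]).
      assert (D3 : is_derive (fun x => (/ x) ^ n) x (- INR n * (/ x) ^ (n + 1))).
      { eapply eq_rect; [apply (is_derive_pow (fun x => / x) n x _ D1)|].
        destruct n as [|m]; [simpl; ring|]. simpl pred.
        replace (S m + 1)%nat with (m + 2)%nat by lia. rewrite pow_add.
        change (INR (S m) * - / x ^ 2 * (/ x) ^ m = - INR (S m) * ((/ x) ^ m * (/ x) ^ 2)).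
        rewrite !pow_inv. ring. }
      eapply eq_rect; [apply (is_derive_Rmult _ _ _ _ _ D3 D2)|].
      unfold flat. destruct Rlt_dec; [|lra]. rewrite !pow_add, !pow_inv. simpl. ring.
Qed.

Lemma Ck_flat (k n : nat) : Ck k (flat n).
Proof.
  revert n. induction k as [|k IH]; intros n; [exact I|].
  exists (fun x => flat (n + 2) x + - INR n * flat (n + 1) x). split; [apply is_derive_flat|].
  apply Ck_plus; [apply IH|apply Ck_scal, IH].
Qed.

(** Positive exactly on [(-2, -1)], inside the negative half-line. The arguments are spelled
    [1 * t + 2] and [-1 * t + -1] to match [Ck_affine]. *)
Definition bump (t : R) : R := flat 0 (1 * t + 2) * flat 0 (-1 * t + -1).

Lemma smooth_bump : smooth bump.
Proof.
  apply Ck_smooth. intros k. apply Ck_mult; apply Ck_affine, Ck_flat.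
Qed.

Lemma supported_bump : supported bump (-2) (-1).
Proof.
  intros t [H|H]; unfold bump, flat; repeat destruct Rlt_dec; lra.
Qed.

Lemma bump_pos (t : R) : -2 < t < -1 -> 0 < bump t.
Proof.
  intros H. unfold bump, flat. destruct Rlt_dec; [|lra]. destruct Rlt_dec; [|lra].
  simpl. rewrite !Rmult_1_l. apply Rmult_lt_0_compat; apply exp_pos.
Qed.

(** * Failure of causality for exponents greater than one *)

Definition Derive2 (f : R -> R) : R -> R := Derive (Derive f).

(** Two derivatives multiply the transform by [(-i w)^2 = - w^2]. Each iterate is again an
    admissible test function, so causality can be applied to all of them. *)
Lemma iter_Derive2 (alpha0 g : R) (x : R * R * R) (phi : R -> R) (a b : R) (k : nat) :
  smooth phi -> supported phi a b ->
  let phik := Nat.iter k Derive2 phi in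
  smooth phik /\ supported phik a b /\
  forall w, spectrum alpha0 g x phik a b w = (RtoC ((-1) ^ k * w ^ (2 * k)) * spectrum alpha0 g x phi a b w)%C.
Proof.
  intros Hs Hsup. induction k as [|k IH]; cbv zeta in *.
  - split; [exact Hs|split; [exact Hsup|]]. intros w. simpl. rewrite Rmult_1_l, Cmult_1_l. reflexivity.
  - destruct IH as [S1 [S2 E]]. change (Nat.iter (S k) Derive2 phi) with (Derive2 (Nat.iter k Derive2 phi)).
    set (p := Nat.iter k Derive2 phi) in *. clearbody p. unfold Derive2.
    split; [apply smooth_Derive, smooth_Derive, S1|].
    split; [apply supported_Derive, supported_Derive, S2|].
    intros w. specialize (E w). unfold spectrum in *.
    rewrite (laplace_Derive (Derive p) a b _ (smooth_Derive _ S1) (supported_Derive _ _ _ S2)).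
    rewrite (laplace_Derive p a b _ S1 S2).
    set (z := ((0, (- w)%R) : C)) in *.
    assert (Z : (z * z)%C = RtoC (-1 * w ^ 2)) by (unfold z, Cmult, RtoC; simpl; apply f_equal2; ring).
    transitivity ((z * z) * (symbol alpha0 g x w * laplace p a b z))%C; [ring|].
    rewrite E, Z, Cmult_assoc, <- RtoC_mult. f_equal. f_equal.
    replace (2 * S k)%nat with (2 * k + 2)%nat by lia. rewrite pow_add. simpl. ring.
Qed.

Lemma fst_RtoC_mult (r : R) (z : C) : fst (RtoC r * z)%C = r * fst z.
Proof. simpl. ring. Qed.

(** Specialises the two independent endpoints to [-r] and [r] and keeps the real part. *)
Lemma is_lim_of_is_RInt_gen (G : R -> C) (c : R) :
  0 < c ->
  @is_RInt_gen C_R_NormedModule (fun w => (RtoC c * G w)%C)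
    (Rbar_locally m_infty) (Rbar_locally p_infty) (RtoC 0) ->
  is_lim (fun r => RInt (fun w => fst (G w)) (- r) r) p_infty 0.
Proof.
  intros Hc H. apply is_lim_spec. intros eps. assert (He := cond_pos eps).
  assert (Hce : 0 < c * eps) by (apply Rmult_lt_0_compat; lra).
  destruct (H (fun y : C => Rabs (fst y) < c * eps)) as [Q R [MQ HQ] [MR HR] HQR].
  { exists (mkposreal _ Hce). intros y [Hy _].
    unfold ball in Hy; simpl in Hy; unfold AbsRing_ball, abs, minus, plus, opp in Hy; simpl in Hy.
    rewrite Ropp_0, Rplus_0_r in Hy. exact Hy. }
  exists (Rmax (- MQ) MR). intros r Hr.
  assert (r1 := Rle_lt_trans _ _ _ (Rmax_l _ _) Hr). assert (r2 := Rle_lt_trans _ _ _ (Rmax_r _ _) Hr).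
  destruct (HQR (- r) r) as [y [Hy1 Hy2]]; [apply HQ; lra|apply HR; lra|]. simpl in Hy1.
  apply is_RInt_fct_extend_fst in Hy1. apply (is_RInt_scal _ _ _ (/ c)) in Hy1.
  assert (E : RInt (fun w => fst (G w)) (- r) r = / c * fst y).
  { apply is_RInt_unique. eapply is_RInt_ext; [|exact Hy1].
    intros w _. change (/ c * fst (RtoC c * G w)%C = fst (G w)). rewrite fst_RtoC_mult. field. lra. }
  rewrite E, Rminus_0_r, Rabs_mult, Rabs_pos_eq by (left; apply Rinv_0_lt_compat, Hc).
  apply Rmult_lt_reg_l with c; [exact Hc|]. rewrite <- Rmult_assoc, Rinv_r by lra. lra.
Qed.

Lemma superlinear_abspow (alpha0 g N : R) : 0 < alpha0 -> 1 < g ->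
  exists B, forall w, N * Rabs w - alpha0 * abspow g w <= B.
Proof.
  intros Ha Hg. set (K := Rabs N + 1).
  assert (HK : 0 < K) by (assert (A := Rabs_pos N); unfold K; lra).
  assert (HKa : 0 < K / alpha0) by (apply Rdiv_lt_0_compat; lra).
  (* The point where [alpha0 y^(g-1) = K]. Beyond it the power dominates [K |w|]; before it [K |w|]
     is at most [K * y0]. *)
  set (y0 := exp (ln (K / alpha0) / (g - 1))).
  assert (Y0 : 0 < y0) by apply exp_pos.
  exists (K * y0). intros w.
  assert (NK : N <= K) by (assert (A := Rle_abs N); unfold K; lra).
  assert (W := Rabs_pos w).
  assert (NW : N * Rabs w <= K * Rabs w) by (apply Rmult_le_compat_r; lra).
  assert (0 <= K * y0) by (apply Rmult_le_pos; lra).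
  destruct (Rle_lt_dec (Rabs w) y0) as [H1|H1].
  - assert (0 <= alpha0 * abspow g w) by (apply Rmult_le_pos; [lra|apply abspow_pos]).
    assert (K * Rabs w <= K * y0) by (apply Rmult_le_compat_l; lra). lra.
  - unfold abspow. destruct Req_EM_T as [->|Hw]; [rewrite Rabs_R0 in H1; lra|].
    assert (E : exp (g * ln (Rabs w)) = Rabs w * exp ((g - 1) * ln (Rabs w))).
    { replace (g * ln (Rabs w)) with (ln (Rabs w) + (g - 1) * ln (Rabs w)) by ring.
      rewrite exp_plus, exp_ln by lra. reflexivity. }
    rewrite E.
    assert (L : K / alpha0 <= exp ((g - 1) * ln (Rabs w))).
    { rewrite <- (exp_ln (K / alpha0)) by exact HKa. apply exp_le.
      replace (ln (K / alpha0)) with ((g - 1) * ln y0) by (unfold y0; rewrite ln_exp; field; lra).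
      apply Rmult_le_compat_l; [lra|]. left. apply ln_increasing; lra. }
    apply Rmult_le_compat_l with (r := alpha0 * Rabs w) in L; [|apply Rmult_le_pos; lra].
    replace (alpha0 * Rabs w * (K / alpha0)) with (K * Rabs w) in L by (field; lra). lra.
Qed.

Lemma not_K_causal_of_gt_1 (alpha0 g : R) :
  0 < alpha0 -> 1 < g -> cos (PI / 2 * g) <> 0 -> ~ K_causal alpha0 g (1, 0, 0).
Proof.
  intros Ha Hg Hcos HK.
  assert (Hpi := PI_RGT_0).
  assert (N1 : norm3 (1, 0, 0) = 1)
    by (unfold norm3; replace (1 ^ 2 + 0 ^ 2 + 0 ^ 2) with 1 by ring; apply sqrt_1).
  set (x := (1, 0, 0)) in *.
  assert (Hs := smooth_bump). assert (Hsup := supported_bump).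
  assert (Hcb := smooth_continuous _ Hs).
  set (G := spectrum alpha0 g x bump (-2) (-1)).
  assert (HGc : forall t, @continuous R_UniformSpace C_UniformSpace G t)
    by (intros; apply spectrum_continuous; [lra|exact Hcb|lra]).
  assert (Hneg : fst (G 0) <= 0).
  { apply (vanishing_even_moments (fun w => fst (G w))).
    - intros t. exact (continuous_comp G fst t (HGc t) (continuous_fst _ _)).
    - intros N. destruct (laplace_decay bump (-2) (-1) Hs Hsup ltac:(lra) ltac:(lra)) as [M [M0 HM]].
      (* The additional exponential of rate 1 absorbs the factor [1 + w^2], through
         [1 + w^2 <= 3 e^|w|]. *)
      destruct (superlinear_abspow alpha0 g (N + 1) Ha Hg) as [B HB].
      exists (3 * M * exp B). intros w.
      destruct (HM (0, - w)) as [L _]; [simpl; lra|].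
      assert (A : Rabs (fst (G w)) <= exp (- (alpha0 * abspow g w)) * M).
      { eapply Rle_trans; [apply fst_le_Cmod|]. unfold G, spectrum.
        rewrite Cmod_mult, Cmod_symbol, N1, Rmult_1_r by exact Hcos.
        apply Rmult_le_compat_l; [left; apply exp_pos|exact L]. }
      assert (Q : 1 + w ^ 2 <= 3 * exp (Rabs w)).
      { assert (Q1 := pow_div_fact_le_exp 2 (Rabs w) (Rabs_pos w)).
        assert (Q2 := pow_div_fact_le_exp 0 (Rabs w) (Rabs_pos w)).
        rewrite pow2_abs in Q1. simpl in Q1, Q2. simpl. lra. }
      assert (W2 := pow2_ge_0 w).
      assert (E1 := exp_pos (N * Rabs w)). assert (E2 := exp_pos (- (alpha0 * abspow g w))).
      apply Rle_trans with (exp (- (alpha0 * abspow g w)) * M * exp (N * Rabs w) * (3 * exp (Rabs w))).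
      + apply Rmult_le_compat; [apply Rmult_le_pos; [apply Rabs_pos|lra]|lra| |exact Q].
        apply Rmult_le_compat_r; lra.
      + replace (exp (- (alpha0 * abspow g w)) * M * exp (N * Rabs w) * (3 * exp (Rabs w)))
          with (3 * M * (exp (N * Rabs w) * exp (Rabs w) * exp (- (alpha0 * abspow g w)))) by ring.
        rewrite <- !exp_plus. apply Rmult_le_compat_l; [lra|]. apply exp_le.
        specialize (HB w). lra.
    - intros k. destruct (iter_Derive2 alpha0 g x bump (-2) (-1) k Hs Hsup) as [S1 [S2 E]].
      set (p := Nat.iter k Derive2 bump) in *.
      assert (HI := HK p (-2) (-1) S1 ltac:(lra) S2).
      assert (HI2 : @is_RInt_gen C_R_NormedModule
        (fun w => (RtoC (/ (2 * PI)) * spectrum alpha0 g x p (-2) (-1) w)%C)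
        (Rbar_locally m_infty) (Rbar_locally p_infty) (RtoC 0)).
      { eapply is_RInt_gen_ext; [|exact HI]. apply filter_forall. intros ab w _. apply K_integrand_eq. }
      apply is_lim_of_is_RInt_gen in HI2; [|apply Rinv_0_lt_compat; lra].
      apply (is_lim_scal_l _ ((-1) ^ k)) in HI2.
      replace (Rbar_mult ((-1) ^ k) 0) with (Finite 0) in HI2 by (simpl; f_equal; ring).
      refine (is_lim_ext _ _ _ _ _ HI2). intros r.
      assert (CS : forall t, continuous (fun w => fst (spectrum alpha0 g x p (-2) (-1) w)) t).
      { intros t. refine (continuous_comp _ fst t _ (continuous_fst _ _)).
        apply spectrum_continuous; [lra|apply smooth_continuous, S1|lra]. }
      transitivity (RInt (fun w => (-1) ^ k * fst (spectrum alpha0 g x p (-2) (-1) w)) (- r) r);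
        [symmetry; apply (RInt_scal (fun w => fst (spectrum alpha0 g x p (-2) (-1) w)) (- r) r ((-1) ^ k)), ex_RInt_cont, CS|].
      apply RInt_ext. intros w _. rewrite E. fold G.
      (* The limit was rescaled by [(-1)^k] to cancel the sign produced by the [2 k] derivatives. *)
      assert (Q : (-1) ^ k * (-1) ^ k = 1).
      { rewrite <- Rpow_mult_distr. replace (-1 * -1) with 1 by ring. apply pow1. }
      transitivity (((-1) ^ k * (-1) ^ k) * w ^ (2 * k) * fst (G w)).
      { rewrite fst_RtoC_mult, <- !Rmult_assoc. reflexivity. }
      rewrite Q. change (@eq R (1 * w ^ (2 * k) * fst (G w)) (fst (G w) * w ^ (2 * k))). ring. }
  assert (Hpos : 0 < fst (laplace bump (-2) (-1) 0)).
  { assert (HL := is_RInt_fct_extend_fst _ _ _ _ (is_RInt_laplace bump (-2) (-1) Hcb 0)).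
    assert (HL2 : is_RInt bump (-2) (-1) (fst (laplace bump (-2) (-1) 0))).
    { eapply is_RInt_ext; [|exact HL]. intros t _. change (fst (cexp (RtoC t * 0) * RtoC (bump t))%C = bump t).
      rewrite Cmult_0_r, cexp_0, Cmult_1_l. reflexivity. }
    apply (@is_RInt_unique R_CompleteNormedModule) in HL2. rewrite <- HL2.
    apply RInt_gt_0; [lra|apply bump_pos|intros; apply Hcb]. }
  assert (E0 : G 0 = laplace bump (-2) (-1) 0).
  { unfold G, spectrum. rewrite symbol_eq.
    assert (A0 : abspow g 0 = 0) by (unfold abspow; destruct Req_EM_T; lra).
    assert (A1 : sgnpow g 0 = 0) by (unfold sgnpow; rewrite A0; destruct Rlt_dec; lra).
    rewrite A0, A1, !Rmult_0_r, !Ropp_0. change ((0, 0) : C) with (RtoC 0).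
    rewrite cexp_0. apply Cmult_1_l. }
  rewrite E0 in Hneg. lra.
Qed.

Theorem theorem2 (c0 alpha0 gamma : R)
  (Hc0 : 0 < c0) (Halpha0 : 0 < alpha0) (Hgamma : 0 < gamma)
  (Hodd : ~ odd_integer gamma) :
  (forall x : R * R * R, K_causal alpha0 gamma x) <-> (0 < gamma < 1).
Proof.
  split.
  - intros H. split; [exact Hgamma|]. apply Rnot_le_lt. intros H1.
    assert (Hpi := PI_RGT_0).
    apply (not_K_causal_of_gt_1 alpha0 gamma); [exact Halpha0| | |apply H].
    (* The borderline [gamma = 1] is the odd integer with [k = 0]. *)
    + destruct H1 as [H1| <-]; [exact H1|]. exfalso. apply Hodd. exists 0%Z. reflexivity.
    (* The zeros [pi/2 + k pi] of the cosine correspond to [gamma = 2 k + 1]. *)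
    + intros Hc. apply Hodd. destruct (cos_eq_0_0 _ Hc) as [k Hk]. exists k.
      rewrite plus_IZR, mult_IZR. apply Rmult_eq_reg_l with (PI / 2); lra.
  - intros H x. apply K_causal_of_lt_1; assumption.
Qed.
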